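(* There are absolute constants $c>0$ and $C>0$ such that the following holds. Let $p$ be a prime. Let $A$ be a set of generators of $G=\operatorname{SL}_2(\mathbb{Z}/p\mathbb{Z})$ with $A=A^{-1}$. Then the mixing time of the lazy random walk on $\Gamma(G,A)$ satisfies $$\operatorname{mix}_{G,A}\le C\,|A|\,(\log p)^{2c+1}.$$
   Context: Let $G$ be a finite group and $A=A^{-1}$ a set of generators of $G$; $\Gamma(G,A)$ is the Cayley graph, with vertex set $G$ and edges $(ag,g)$, $g\in G$, $a\in A$. Let $\delta_A$ be the characteristic function of $A$ and define the probability distribution $\psi$ on $G$ by $\psi(g)=\frac{1}{2|A|}\delta_A(g)$ if $g$ is not the identity and $\psi(g)=\frac{1}{2|A|}\delta_A(g)+\frac12$ if $g$ is the identity. Let $T_\psi(G,A)=\{\psi(y^{-1}x)\}_{x,y\in G}$. For a positive integer $n$ and $g_0\in G$, let $\phi_{n,g_0}=(T_\psi(G,A))^n\delta_{g_0}$, where $\delta_{g_0}$ is the characteristic function of $\{g_0\}$ seen as a vector of length $|G|$. The mixing time $\operatorname{mix}_{G,A}$ is the smallest positive integer $n$ such that $\sum_{g\in G}\left|\phi_{n,g_0}(g)-\frac{1}{|G|}\right|\le\frac12$; it does not depend on $g_0$. *)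

(* Defs.v *)
From HB Require Import structures.
From mathcomp Require Import all_boot all_order all_algebra all_fingroup.
From mathcomp Require Import reals exp.

Set Implicit Arguments.
Unset Strict Implicit.
Unset Printing Implicit Defensive.

Import Order.TTheory GRing.Theory Num.Theory.

Local Open Scope ring_scope.

(* ['GL_n[F]] consists of matrices of size [n.-1.+1], so [0 < n] is the
   meaningful range. *)
Definition SLset (n : nat) (F : finComUnitRingType) : {set {'GL_n[F]}} :=
  [set u | \det (GLval u) == 1].

Lemma SLset_group_set (n : nat) (F : finComUnitRingType) :
  group_set (SLset n F).
Proof.
apply/group_setP; split=> [|u v]; rewrite !inE; first by rewrite GL_1E det1.
by rewrite GL_MxE det_mulmx => /eqP -> /eqP ->; rewrite mulr1.
Qed.

Canonical SL (n : nat) (F : finComUnitRingType) : {group {'GL_n[F]}} :=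
  Group (SLset_group_set n F).

Section LazyRandomWalk.

Variables (R : realType) (gT : finGroupType).
Variables (G : {group gT}) (A : {set gT}).

(* The equality [<<A>> = G] forces [A \subset G]. *)
Definition symmetric_generators : Prop := (A^-1 = A)%g /\ <<A>>%g = G.

Definition lazy_dist (g : gT) : R :=
  if g == 1%g then (2 * #|A|%:R)^-1 * (g \in A)%:R + 2^-1
  else (2 * #|A|%:R)^-1 * (g \in A)%:R.

(* Vectors and matrices indexed by [G] are indexed by ['I_#|G|] through the
   enumeration [enum_val] of [G]; the row index is [x], the column index [y]. *)
Definition transition_mx : 'M[R]_#|G| :=
  \matrix_(x, y) lazy_dist ((enum_val y)^-1 * enum_val x)%g.

Definition delta_vec (g0 : gT) : 'cV[R]_#|G| :=
  \col_x (enum_val x == g0)%:R.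

Definition walk_dist (n : nat) (g0 : gT) : 'cV[R]_#|G| :=
  transition_mx ^+ n *m delta_vec g0.

Definition mixed (n : nat) (g0 : gT) : Prop :=
  \sum_(x < #|G|) `|walk_dist n g0 x ord0 - #|G|%:R^-1| <= 2^-1.

(* The mixing time does not depend on the starting point: [n] is the least
   positive mixed time for every [g0] in [G]. *)
Definition is_mixing_time (n : nat) : Prop :=
  forall g0 : gT, g0 \in G ->
    [/\ (0 < n)%N, mixed n g0
      & forall m : nat, (0 < m)%N -> mixed m g0 -> (n <= m)%N].

End LazyRandomWalk.

(* Main.v *)
(* The mixing time is at most a constant times |A| d^2 log |G|, where d is the
   diameter of the Cayley graph, and d is polylogarithmic in p.

   Spectral part: if every element of G is a product of d elements of
   1 :|: A, then comparing |f(xg) - f(x)| with the steps of such a product gives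
   a Poincare inequality, so that the lazy walk contracts the L^2 distance to
   the uniform distribution by 1 - 1 / (2 |A| d^2) at each step.

   Diameter part: a generating set A of SL_2(F_q) satisfies A^115 = G or
   |A^115| >= |A|^(25/24), unless |A| is bounded. Suppose A does
   not grow. Sending (x, y, z) to (xy, yz) shows that a trace class meets A^k in
   at most about |A|^(2/3) elements, hence the centralizer of a regular element
   of A^k contains at least about |A|^(1/3) elements of A^2. This property passes
   from a torus to its conjugates under A, hence to all the q^2 conjugates,
   which are almost disjoint: so |A| is close to q^3. But then a pigeonhole
   argument in the Borel subgroup, together with the fact that some sum E + xi E
   of large subsets of F_q covers more than half of F_q, puts all unipotent
   elements into A^16, and A^115 = G. *)
From HB Require Import structures.
Require Import Defs.
From mathcomp Require Import all_boot all_order all_algebra all_fingroup.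
From mathcomp Require Import ring lra zify.
From mathcomp Require Import reals sequences exp.

Set Implicit Arguments.
Unset Strict Implicit.
Unset Printing Implicit Defensive.

Import Order.TTheory GRing.Theory Num.Theory.
Local Open Scope ring_scope.

Lemma card_le_fiber (T U : finType) (S : {set T}) (f : T -> U) (k : nat) :
  (forall s, s \in S -> (#|[set s' in S | f s' == f s]| <= k)%N) ->
  (#|S| <= k * #|f @: S|)%N.
Proof.
move=> fibk; rewrite -sum1_card (partition_big_imset f) /= mulnC.
rewrite -sum_nat_const; apply: leq_sum => u /imsetP[s sS ->].
rewrite sum1dep_card; apply: leq_trans (fibk s sS).
by rewrite subset_leq_card //; apply/subsetP => x; rewrite !inE.
Qed.

Lemma card_le2 (T : finType) (S : {set T}) :
  (forall x y z, x \in S -> y \in S -> z \in S ->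
     x != y -> y != z -> z != x -> False) ->
  (#|S| <= 2)%N.
Proof.
move=> S3; rewrite leqNgt; apply/negP => /card_gt2P[x [y [z]]].
by case=> -[xS yS zS] [xy yz zx]; apply: (S3 x y z).
Qed.

Lemma card_big_fiber (T U : finType) (S : {set T}) (f : T -> U) :
  (0 < #|S|)%N ->
  exists2 s, s \in S & (#|S| <= #|[set s' in S | f s' == f s]| * #|U|)%N.
Proof.
move=> S0.
have [x0 x0S] : exists x, x \in S by apply/set0Pn; rewrite -card_gt0.
case: (arg_maxnP (fun s => #|[set s' in S | f s' == f s]|) x0S) => s sS smax.
exists s => //; apply: leq_trans (card_le_fiber smax) _.
by rewrite leq_mul2l max_card orbT.
Qed.

Lemma card_bigcup_le (I T : finType) (P : pred I) (B : I -> {set T}) :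
  (#|\bigcup_(i | P i) B i| <= \sum_(i | P i) #|B i|)%N.
Proof.
elim/big_rec2: _ => [|i n S _ IH]; first by rewrite cards0.
by apply: leq_trans (leq_card_setU _ _) _; rewrite leq_add2l.
Qed.

Lemma Cauchy_Schwarz_sum (R : realDomainType) (I : finType) (P : pred I) (f : I -> R) :
  (\sum_(i | P i) f i) ^+ 2 <= #|[pred i | P i]|%:R * \sum_(i | P i) f i ^+ 2.
Proof.
have h : 0 <= \sum_(i | P i) \sum_(j | P j) (f i - f j) ^+ 2.
  by apply: sumr_ge0 => i _; apply: sumr_ge0 => j _; apply: sqr_ge0.
rewrite -(ler_pMn2r (n := 2)) // -subr_ge0; apply: le_trans h _.
rewrite le_eqVlt; apply/orP; left; apply/eqP.
have cst (c : R) : \sum_(i | P i) c = #|[pred i | P i]|%:R * c.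
  by rewrite sumr_const mulr_natl.
under eq_bigr => i _ do under eq_bigr => j _ do rewrite sqrrB.
under eq_bigr => i _ do rewrite big_split /= big_split /= sumrN cst sumrMnl -mulr_sumr.
rewrite big_split /= big_split /= -mulr_sumr sumrN cst sumrMnl -mulr_suml.
ring.
Qed.

Lemma collision_bound (T U : finType) (S : {set T}) (f : T -> U) :
  (#|S| ^ 2 <=
   #|f @: S| * \sum_(s in S) #|[set s' in S | f s' == f s]|)%N.
Proof.
pose n u := #|[set s in S | f s == u]|.
have -> : (\sum_(s in S) #|[set s' in S | f s' == f s]| =
           \sum_(u in f @: S) n u ^ 2)%N.
  rewrite (partition_big_imset f) /=; apply: eq_bigr => u _.
  rewrite (eq_bigr (fun=> n u)); last by move=> s /andP[_ /eqP ->].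
  rewrite sum_nat_const -mulnn; congr (_ * _)%N.
  by rewrite /n -sum1_card -sum1dep_card; apply: eq_bigl => s; rewrite unfold_in.
have -> : (#|S| = \sum_(u in f @: S) n u)%N.
  rewrite -sum1_card (partition_big_imset f) /=; apply: eq_bigr => u _.
  by rewrite sum1dep_card.
rewrite -(ler_nat int) natrX natr_sum natrM natr_sum.
under [X in _ <= _ * X]eq_bigr => u _ do rewrite natrX.
exact: Cauchy_Schwarz_sum.
Qed.

Lemma Bernoulli (R : realDomainType) (x : R) n : 0 <= x -> 1 + n%:R * x <= (1 + x) ^+ n.
Proof.
move=> x0; elim: n => [|n IHn]; first by rewrite mul0r addr0 expr0.
rewrite exprSr; apply: (@le_trans _ _ ((1 + n%:R * x) * (1 + x))).
  have : 0 <= n%:R * x * x by rewrite !mulr_ge0.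
  by rewrite -natr1; lra.
by rewrite ler_wpM2r //; lra.
Qed.

(** * Products of sets in a finite group *)

Section SetPowers.
Local Open Scope group_scope.
Variable gT : finGroupType.
Implicit Types A B : {set gT}.

Lemma expgs_mem1 A n : 1 \in A -> 1 \in A ^+ n.
Proof.
move=> A1; elim: n => [|n IHn]; first by rewrite expg0 set11.
by rewrite expgS -(mulg1 1); apply: mem_mulg.
Qed.

Lemma expgsS A m n : 1 \in A -> (m <= n)%N -> A ^+ m \subset A ^+ n.
Proof.
move=> A1 /subnKC <-; rewrite expgnDr; apply: mulg_subl.
exact: expgs_mem1.
Qed.

Lemma mem_expgsW A m n x :
  1 \in A -> (m <= n)%N -> x \in A ^+ m -> x \in A ^+ n.
Proof. by move=> A1 mn; apply/subsetP/expgsS. Qed.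

Lemma mem_expgsM A m n x y :
  x \in A ^+ m -> y \in A ^+ n -> x * y \in A ^+ (m + n).
Proof. by move=> Ax Ay; rewrite expgnDr mem_mulg. Qed.

Lemma mem_expgsV A n x : A^-1 = A -> (x^-1 \in A ^+ n) = (x \in A ^+ n).
Proof.
move=> AV.
have sV m y : y \in A ^+ m -> y^-1 \in A ^+ m.
  elim: m y => [|m IHm] y; first by rewrite expg0 !inE => /eqP ->; rewrite invg1.
  rewrite [in X in X -> _]expgS => /mulsgP[a b aA bA ->]; rewrite invMg expgSr.
  by rewrite mem_mulg ?IHm // -AV inE invgK.
by apply/idP/idP => /sV; rewrite ?invgK.
Qed.

Lemma mem_expgsJ A m n x y : A^-1 = A ->
  x \in A ^+ n -> y \in A ^+ m -> x * y * x^-1 \in A ^+ (n + m + n).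
Proof.
by move=> AV xA yA; rewrite mem_expgsM ?mem_expgsV // mem_expgsM.
Qed.

Lemma expgs_sub A (G : {group gT}) n : A \subset G -> A ^+ n \subset G.
Proof.
move=> sAG; elim: n => [|n IHn]; first by rewrite expg0 sub1G.
by rewrite expgS mul_subG.
Qed.

Lemma expgs_grow A n :
  1 \in A -> A ^+ n = <<A>> \/ (n < #|(A ^+ n)%g|)%N.
Proof.
move=> A1; elim: n => [|n [IHn|IHn]]; first by right; rewrite expg0 cards1.
  left; apply/eqP; rewrite eqEsubset expgs_sub ?subset_gen // -IHn.
  exact: expgsS.
have [eqA | neqA] := eqVneq (A ^+ n.+1) (A ^+ n); last first.
  right; apply: leq_ltn_trans IHn _; apply: proper_card.
  by rewrite properEneq eq_sym neqA expgsS.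
left; rewrite eqA; apply/eqP; rewrite eqEsubset expgs_sub ?subset_gen //.
apply/subsetP => x /gen_prodgP[m [c cA ->]].
elim: m c cA => [|m IHm] c cA; first by rewrite big_ord0 expgs_mem1.
by rewrite big_ord_recl -eqA expgS mem_mulg // IHm.
Qed.

Lemma expgs_full A : 1 \in A -> exists n, A ^+ n = <<A>>.
Proof.
move=> A1; exists #|gT|; case: (expgs_grow #|gT| A1) => //.
by rewrite ltnNge max_card.
Qed.

(* Two elements of [A] conjugating [g] to the same element differ by an element of
   ['C[g]]. *)
Lemma card_conj_cent A g : A^-1 = A ->
  (#|A| <= #|(A ^+ 2 :&: 'C[g])%g| * #|[set (a * g * a^-1)%g | a in A]|)%N.
Proof.
move=> AV; apply: card_le_fiber => a aA.
rewrite -(card_imset _ (mulgI a^-1)) subset_leq_card //.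
apply/subsetP => _ /imsetP[b bS ->]; move: bS.
rewrite inE => /andP[bA /eqP eqab]; rewrite inE.
rewrite expgS expg1 mem_mulg //=; last by rewrite -AV inE invgK.
apply/cent1P; apply: (mulgI a); apply: (mulIg b^-1).
by rewrite !mulgA mulgV mul1g eqab mulgK.
Qed.

End SetPowers.

Lemma expgs_sym (gT : finGroupType) (A : {set gT}) n :
  (A^-1 = A)%g -> ((A ^+ n)^-1 = A ^+ n)%g.
Proof. by move=> AV; apply/setP => x; rewrite inE mem_expgsV. Qed.

Lemma expgs_gen (gT : finGroupType) (A : {set gT}) n :
  (0 < n)%N -> 1%g \in A -> <<A>>%g = [set: gT] -> <<A ^+ n>>%g = [set: gT].
Proof.
move=> n0 A1 genA; apply/eqP; rewrite eqEsubset subsetT -genA genS //.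
by rewrite -{1}(expg1 A); apply: expgsS.
Qed.

Lemma conj_quotient (gT : finGroupType) (x x' w w' a : gT) :
  (x * (a * w * a^-1) = x' * (a * w' * a^-1))%g ->
  (a^-1 * (x'^-1 * x) * a = w' * w^-1)%g.
Proof.
move=> eq1; apply: (mulIg w); rewrite mulgKV.
apply: (mulgI (x' * a)%g); apply: (mulIg a^-1%g).
by move: eq1; rewrite !mulgA mulgK mulgV mul1g.
Qed.

Lemma conj_conj (gT : finGroupType) (k x y : gT) :
  (k * (x * y * x^-1) * k^-1 =
   (k * x * k^-1) * (k * y * k^-1) * (k * x * k^-1)^-1)%g.
Proof. by rewrite !invMg invgK !mulgA !mulgKV. Qed.

Lemma conj_mul (gT : finGroupType) (k x y : gT) :
  (k * (x * y) * k^-1 = (k * x * k^-1) * (k * y * k^-1))%g.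
Proof. by rewrite !mulgA mulgKV. Qed.

Lemma conj_inv (gT : finGroupType) (k x : gT) :
  (k * x^-1 * k^-1 = (k * x * k^-1)^-1)%g.
Proof. by rewrite !invMg invgK mulgA. Qed.

(** * Sums of dilates in a finite field *)

Section Field.
Variable F : finFieldType.
Implicit Types (E Xi : {set F}).

(* The average over nonzero [xi] of the number of coincidences
   [e1 + xi e2 = e3 + xi e4] is close to the minimum [#|E| ^ 4 / #|F|] allowed
   by Cauchy-Schwarz, so most dilates [E + xi E] fill more than half of [F]. *)
Lemma dilate_sumset E Xi : 0 \notin Xi -> (2 * #|F| ^ 2 < #|E| ^ 2 * #|Xi|)%N ->
  exists2 xi, xi \in Xi & (#|F| < 2 * #|[set (e.1 + xi * e.2)%R | e in setX E E]|)%N.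
Proof.
move=> Xi0 big; set q := #|F| in big *; set n := #|E| in big *.
apply/exists_inP; apply: contraT; rewrite negb_exists_in => /forall_inP small.
pose S := setX E E; pose f (xi : F) (e : F * F) := e.1 + xi * e.2.
pose col xi := (\sum_(s in S) #|[set s' in S | f xi s' == f xi s]|)%N.
have cS : #|S| = (n ^ 2)%N by rewrite cardsX mulnn.
have colq xi : (n ^ 4 <= q * col xi)%N.
  have := collision_bound S (f xi); rewrite cS -expnM => h.
  by apply: leq_trans h _; rewrite leq_mul2r max_card orbT.
have colXi xi : xi \in Xi -> (2 * n ^ 4 <= q * col xi)%N.
  move=> /small; rewrite -leqNgt => h2.
  have := collision_bound S (f xi); rewrite cS -expnM => h.
  apply: (@leq_trans (2 * (#|f xi @: S| * col xi))); first by rewrite leq_mul2l.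
  by rewrite mulnA leq_mul2r h2 orbT.
have colsum : (\sum_(xi in [set~ 0%R]) col xi <= q.-1 * n ^ 2 + n ^ 4)%N.
  rewrite exchange_big /=.
  apply: (@leq_trans (\sum_(s in S) (q.-1 + n ^ 2))); last first.
    by rewrite sum_nat_const cS mulnDr -expnD mulnC.
  apply: leq_sum => s sS.
  under eq_bigr => xi _ do rewrite -sum1dep_card big_mkcondr.
  rewrite exchange_big (bigD1 s) //=; apply: leq_add.
    under eq_bigr => xi _ do rewrite eqxx.
    by rewrite sum1_card cardsC1.
  apply: (@leq_trans (\sum_(i in S | i != s) 1)); last first.
    by rewrite -cS -sum1_card big_mkcondr leq_sum // => i _; case: ifP.
  apply: leq_sum => -[u v] /andP[_ us]; rewrite -big_mkcondr sum1dep_card.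
  case: s sS us => u' v' _ us; rewrite leqNgt; apply/negP => /card_gt1P[x [y []]].
  rewrite !inE /f /= => /andP[x0 /eqP hx] /andP[y0 /eqP hy] /negP[].
  have e : (x - y) * (v - v') = 0.
    transitivity ((u + x * v) - (u' + x * v') - ((u + y * v) - (u' + y * v'))).
      by ring.
    by rewrite hx hy !subrr.
  move/eqP: e; rewrite mulf_eq0 !subr_eq0 => /orP[//|/eqP vv'].
  by case/negP: us; move: hx; rewrite vv' => /addIr ->.
have Xisub : Xi \subset [set~ 0%R].
  by apply/subsetP => x xXi; rewrite !inE; apply: contraNneq Xi0 => <-.
have low : (#|Xi| * n ^ 4 + q.-1 * n ^ 4 <= q * \sum_(xi in [set~ 0%R]) col xi)%N.
  have <- : (\sum_(xi in [set~ 0%R]) ((xi \in Xi) * n ^ 4 + n ^ 4) =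
             #|Xi| * n ^ 4 + q.-1 * n ^ 4)%N.
    rewrite big_split /= sum_nat_const cardsC1 -/q -big_distrl /=; congr (_ * _ + _)%N.
    rewrite -sum1_card [RHS]big_mkcond /= [LHS]big_mkcond /=.
    apply: eq_bigr => x _; rewrite !inE; case: (boolP (x \in Xi)) => xXi.
      by have := subsetP Xisub x xXi; rewrite !inE => ->.
    by case: ifP.
  rewrite big_distrr; apply: leq_sum => xi _ /=.
  have [/colXi|_] := boolP (xi \in Xi); last by rewrite mul0n add0n.
  by rewrite mul1n mul2n addnn.
have q0 : (0 < q)%N by apply/card_gt0P; exists 0.
have nq : (n <= q)%N := max_card _.
have := leq_trans low (leq_mul (leqnn q) colsum).
have n0 : (0 < n)%N by move: big; case: (n) => //; rewrite exp0n.
have -> : (#|Xi| * n ^ 4 = (n ^ 2 * #|Xi|) * n ^ 2)%N.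
  by rewrite (expnD n 2 2); ring.
set w := (n ^ 2 * #|Xi|)%N in big *.
have : ((2 * q ^ 2).+1 * n ^ 2 <= w * n ^ 2)%N by rewrite leq_mul2r big orbT.
have n4 : (n ^ 4 <= q ^ 2 * n ^ 2)%N by rewrite (expnD n 2 2) leq_mul2r leq_sqr nq orbT.
have qE : q = q.-1.+1 by rewrite prednK.
have : (0 < n ^ 2)%N by rewrite expn_gt0 n0.
move: n4; rewrite qE; move: (q.-1) (n ^ 2)%N (n ^ 4)%N (w * n ^ 2)%N => k a b c /=; nia.
Qed.

Lemma double_cover (S : {set F}) (x : F) : (#|F| < 2 * #|S|)%N ->
  exists s t, [/\ s \in S, t \in S & x = s + t].
Proof.
move=> big; pose T := [set x - s | s in S].
have cT : #|T| = #|S| by rewrite card_imset // => a b /addrI/oppr_inj.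
have : (0 < #|S :&: T|)%N.
  have := cardsUI S T; rewrite cT.
  have : (#|S :|: T| <= #|F|)%N by apply: max_card.
  by move: #|_ :|: _| #|_ :&: _|; lia.
rewrite card_gt0 => /set0Pn[s /setIP[sS /imsetP[t tS st]]].
by exists s, t; split=> //; rewrite st subrK.
Qed.

End Field.

(** * The group SL_2(F) *)

(* A copy of [SL 2 F] in which membership is built into the type and the four
   entries are directly accessible. *)
Record sl2 (F : finFieldType) := Sl2 {
  entries : F * F * F * F;
  _ : entries.1.1.1 * entries.2 == 1 + entries.1.1.2 * entries.1.2 }.

Section SL2Group.
Variable F : finFieldType.

HB.instance Definition _ := [isSub for @entries F].
HB.instance Definition _ := [Finite of sl2 F by <:].

Implicit Types x y z : sl2 F.

Definition e11 x : F := (entries x).1.1.1.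
Definition e12 x : F := (entries x).1.1.2.
Definition e21 x : F := (entries x).1.2.
Definition e22 x : F := (entries x).2.

Lemma entriesP x y :
  e11 x = e11 y -> e12 x = e12 y -> e21 x = e21 y -> e22 x = e22 y -> x = y.
Proof.
case: x y => [[[[a b] c] d] p] [[[[a' b'] c'] d'] p'].
by rewrite /e11 /e12 /e21 /e22 /= => *; apply/val_inj => /=; congr (_, _, _, _).
Qed.

Lemma sl2P x : e11 x * e22 x = 1 + e12 x * e21 x.
Proof. by apply/eqP; case: x. Qed.

Fact sl2_one_subproof : (1 : F) * 1 == 1 + 0 * 0.
Proof. by rewrite mulr1 mulr0 addr0. Qed.

Fact sl2_inv_subproof x : e22 x * e11 x == 1 + - e12 x * - e21 x.
Proof. by rewrite mulrNN mulrC; apply/eqP/sl2P. Qed.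

Fact sl2_mul_subproof x y :
  (e11 x * e11 y + e12 x * e21 y) * (e21 x * e12 y + e22 x * e22 y) ==
  1 + (e11 x * e12 y + e12 x * e22 y) * (e21 x * e11 y + e22 x * e21 y).
Proof.
have -> : (e11 x * e11 y + e12 x * e21 y) * (e21 x * e12 y + e22 x * e22 y) =
  (e11 x * e12 y + e12 x * e22 y) * (e21 x * e11 y + e22 x * e21 y) +
  (e11 x * e22 x - e12 x * e21 x) * (e11 y * e22 y - e12 y * e21 y) by ring.
by rewrite !sl2P !addrK mulr1 addrC.
Qed.

Definition sl2_one : sl2 F := @Sl2 F (1, 0, 0, 1) sl2_one_subproof.
Definition sl2_inv x : sl2 F :=
  @Sl2 F (e22 x, - e12 x, - e21 x, e11 x) (sl2_inv_subproof x).
Definition sl2_mul x y : sl2 F :=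
  @Sl2 F (e11 x * e11 y + e12 x * e21 y, e11 x * e12 y + e12 x * e22 y,
          e21 x * e11 y + e22 x * e21 y, e21 x * e12 y + e22 x * e22 y)
         (sl2_mul_subproof x y).

Fact sl2_mulA : associative sl2_mul.
Proof.
by move=> x y z; apply: entriesP; rewrite /sl2_mul /e11 /e12 /e21 /e22 /=; ring.
Qed.

Fact sl2_mul1 : left_id sl2_one sl2_mul.
Proof.
by move=> x; apply: entriesP; rewrite /sl2_mul /e11 /e12 /e21 /e22 /=; ring.
Qed.

Fact sl2_mulV : left_inverse sl2_one sl2_inv sl2_mul.
Proof.
move=> x; have := sl2P x; rewrite /e11 /e12 /e21 /e22 => xP.
by apply: entriesP; rewrite /sl2_mul /e11 /e12 /e21 /e22 /=; ring: xP.
Qed.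

HB.instance Definition _ :=
  Finite_isGroup.Build (sl2 F) sl2_mulA sl2_mul1 sl2_mulV.

Lemma e11M x y : e11 (x * y)%g = e11 x * e11 y + e12 x * e21 y.
Proof. by []. Qed.
Lemma e12M x y : e12 (x * y)%g = e11 x * e12 y + e12 x * e22 y.
Proof. by []. Qed.
Lemma e21M x y : e21 (x * y)%g = e21 x * e11 y + e22 x * e21 y.
Proof. by []. Qed.
Lemma e22M x y : e22 (x * y)%g = e21 x * e12 y + e22 x * e22 y.
Proof. by []. Qed.
Lemma e11_1 : e11 1%g = 1. Proof. by []. Qed.
Lemma e12_1 : e12 1%g = 0. Proof. by []. Qed.
Lemma e21_1 : e21 1%g = 0. Proof. by []. Qed.
Lemma e22_1 : e22 1%g = 1. Proof. by []. Qed.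
Lemma e11V x : e11 x^-1%g = e22 x. Proof. by []. Qed.
Lemma e12V x : e12 x^-1%g = - e12 x. Proof. by []. Qed.
Lemma e21V x : e21 x^-1%g = - e21 x. Proof. by []. Qed.
Lemma e22V x : e22 x^-1%g = e11 x. Proof. by []. Qed.

Lemma sl2_ex (a b c d : F) : a * d = 1 + b * c ->
  exists x, [/\ e11 x = a, e12 x = b, e21 x = c & e22 x = d].
Proof. by move=> /eqP abcd; exists (@Sl2 F (a, b, c, d) abcd). Qed.

End SL2Group.

Definition eM := (e11M, e12M, e21M, e22M).
Definition e1 := (e11_1, e12_1, e21_1, e22_1).
Definition eV := (e11V, e12V, e21V, e22V).

Section Lines.
Variable F : finFieldType.
Implicit Types (x y z g h : sl2 F) (A B X : {set sl2 F}).

Definition tr x : F := e11 x + e22 x.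

Lemma trMC x y : tr (x * y)%g = tr (y * x)%g.
Proof. by rewrite /tr !eM; ring. Qed.

Lemma trJ x y : tr (x * y * x^-1)%g = tr y.
Proof. by rewrite trMC mulgA mulVg mul1g. Qed.

(* The points of the projective line over [F] are [Some s = [s : 1]] and
   [None = [1 : 0]]; [to_inf l] moves [l] to [[1 : 0]], whose stabilizer is
   the group of upper triangular matrices. *)
Definition to_inf (l : option F) : sl2 F :=
  if l is Some s then
    odflt 1%g [pick x | [&& e11 x == 0, e12 x == 1, e21 x == -1 & e22 x == s]]
  else 1%g.

Lemma to_inf_Some s : [/\ e11 (to_inf (Some s)) = 0, e12 (to_inf (Some s)) = 1,
  e21 (to_inf (Some s)) = -1 & e22 (to_inf (Some s)) = s].
Proof.
rewrite /=; case: pickP => [x /and4P[/eqP -> /eqP -> /eqP -> /eqP ->]|no] //.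
have [x [h1 h2 h3 h4]] : exists x, [/\ e11 x = 0, e12 x = 1, e21 x = -1
  & e22 x = s] by apply: sl2_ex; ring.
by have := no x; rewrite h1 h2 h3 h4 !eqxx.
Qed.

Definition fixl x (l : option F) : bool :=
  e21 (to_inf l * x * (to_inf l)^-1)%g == 0.

Lemma fixl_None x : fixl x None = (e21 x == 0).
Proof. by rewrite /fixl /= mul1g invg1 mulg1. Qed.

Lemma fixl_Some x s :
  fixl x (Some s) = (e21 x * s ^+ 2 + (e22 x - e11 x) * s == e12 x).
Proof.
have [h1 h2 h3 h4] := to_inf_Some s.
rewrite /fixl !eM !eV ?h1 ?h2 h3 h4 -[RHS]subr_eq0.
by congr (_ == 0); ring.
Qed.

Definition share_line x y : bool := [exists l, fixl x l && fixl y l].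

Lemma card_fixl x : tr x != 2 -> tr x != -2 ->
  (#|[set l | fixl x l]| <= 2)%N.
Proof.
move=> x2 xm2; have xGP := sl2P x.
have diag_neq : e21 x = 0 -> e22 x - e11 x != 0.
  move=> x21; apply/eqP => /eqP; rewrite subr_eq0 => /eqP x22.
  have : (e11 x - 1) * (e11 x + 1) = 0 by rewrite x22 x21 in xGP; ring: xGP.
  move/eqP; rewrite mulf_eq0 subr_eq0 addr_eq0 => /orP[] /eqP x11.
    by move/negP: x2; apply; rewrite /tr x22 x11.
  by move/negP: xm2; apply; rewrite /tr x22 x11; apply/eqP; ring.
have lin (s1 s2 : F) : s1 != s2 ->
    fixl x (Some s1) -> fixl x (Some s2) ->
    e21 x * (s1 + s2) + (e22 x - e11 x) = 0.
  rewrite !fixl_Some -subr_eq0 => s12 /eqP f1 /eqP f2.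
  apply/eqP; rewrite -(mulrI_eq0 _ (mulfI s12)); apply/eqP.
  rewrite -[RHS](subrr (e12 x)) -{1}f1 -f2; ring.
have NoneF s1 s2 : s1 != s2 -> e21 x = 0 ->
    fixl x (Some s1) -> fixl x (Some s2) -> False.
  move=> s12 x21 f1 f2; have := lin _ _ s12 f1 f2.
  by rewrite x21 mul0r add0r; apply/eqP/diag_neq.
apply: card_le2 => -[s1|] [s2|] [s3|]; rewrite !inE ?fixl_None => //.
- move=> f1 f2 f3; have [<- /eqP //|s12 _] := eqVneq s1 s2.
  have [<- /eqP //|s23 _] := eqVneq s2 s3.
  have [<- /eqP //|s31 _] := eqVneq s3 s1.
  have h1 := lin _ _ s12 f1 f2; have h2 := lin _ _ s23 f2 f3.
  have : e21 x * (s3 - s1) = 0.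
    by rewrite -[RHS](subrr 0) -{1}h2 -h1; ring.
  move/eqP; rewrite mulf_eq0 subr_eq0 (negPf s31) orbF => /eqP x21.
  exact: NoneF s12 x21 f1 f2.
- move=> f1 f2 /eqP x21 s12 _ _; exact: (NoneF s1 s2).
- move=> f1 /eqP x21 f3 _ _ s31; exact: (NoneF s3 s1).
- move=> /eqP x21 f2 f3 _ s23 _; exact: (NoneF s2 s3).
Qed.

End Lines.

(** * Trace classes *)

Section Fibers.
Variable F : finFieldType.
Implicit Types (x y z g h : sl2 F) (A B X : {set sl2 F}).

Lemma fixlM x y l : fixl x l -> fixl y l -> fixl (x * y)%g l.
Proof.
rewrite /fixl; set k := to_inf l => /eqP fx /eqP fy.
by rewrite conj_mul e21M fx fy mul0r mulr0 addr0.
Qed.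

Lemma fixlV x l : fixl x l -> fixl x^-1%g l.
Proof.
rewrite /fixl; set k := to_inf l => /eqP fx.
by rewrite conj_inv e21V fx oppr0.
Qed.

Lemma card_line_fiber x x' w w' a :
    e21 x = 0 -> e21 x' = 0 -> e21 w = 0 -> e21 w' = 0 -> e21 a != 0 ->
    e11 x = e11 x' -> (x * (a * w * a^-1) = x' * (a * w' * a^-1))%g ->
  x = x'.
Proof.
move=> x21 x'21 w21 w'21 a21 x11 eq1.
set D := (x'^-1 * x)%g.
have Da : (a^-1 * D * a = w' * w^-1)%g by apply: conj_quotient.
have xD : x = (x' * D)%g by rewrite mulKVg.
have x'GP := sl2P x'.
have D11 : e11 D = 1.
  by rewrite eM e11V x21 mulr0 addr0 x11 mulrC x'GP x'21 mulr0 addr0.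
have D21 : e21 D = 0.
  by rewrite eM e21V e22V x21 x'21; ring.
clearbody D; have D22 : e22 D = 1.
  by have := sl2P D; rewrite D11 D21 mul1r mulr0 addr0.
have D12 : e12 D = 0.
  have : e21 (w' * w^-1)%g = 0 by rewrite eM e21V w21 w'21; ring.
  rewrite -Da !eM e21V e22V D11 D21 D22 => h.
  have : e21 a ^+ 2 * e12 D = 0.
    by rewrite -[LHS]opprK -[RHS]oppr0; congr (- _); rewrite -[RHS]h; ring.
  by move/eqP; rewrite mulf_eq0 expf_eq0 (negPf a21) /= => /eqP.
have D1 : D = 1%g by apply: entriesP; rewrite ?D11 ?D12 ?D21 ?D22 e1.
by rewrite xD D1 mulg1.
Qed.

Lemma card_line X a l t : ~~ fixl a l ->
    (forall x, x \in X -> tr x = t /\ fixl x l) ->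
  (#|X| ^ 2 <= 2 * #|[set (x * (a * w * a^-1))%g | x in X, w in X]|)%N.
Proof.
move=> nfa Xt; set k := to_inf l.
pose f (u : sl2 F * sl2 F) := (u.1 * (a * u.2 * a^-1))%g.
have -> : [set (x * (a * w * a^-1))%g | x in X, w in X] = f @: setX X X.
  apply/setP => u; apply/imset2P/imsetP => [[x w xX wX ->]|].
    by exists (x, w); rewrite // inE xX.
  by case=> -[x w]; rewrite inE => /andP[/= xX wX] ->; exists x w.
rewrite -mulnn -cardsX; apply: card_le_fiber => -[x0 w0] _.
have e21X x : x \in X -> e21 (k * x * k^-1)%g = 0 by case/Xt=> _ /eqP.
have inj x w x' w' : x \in X -> w \in X -> x' \in X -> w' \in X ->
    f (x, w) = f (x', w') ->
    e11 (k * x * k^-1)%g = e11 (k * x' * k^-1)%g -> (x, w) = (x', w').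
  move=> xX wX x'X w'X eqf eq11; have eqx : x = x'.
    apply: (mulgI k); apply: (mulIg k^-1%g).
    apply: (@card_line_fiber _ _ (k * w * k^-1)%g (k * w' * k^-1)%g
             (k * a * k^-1)%g) => //; try exact: e21X.
    by rewrite -!conj_conj -!conj_mul [(x * _)%g]eqf.
  move: eqf; rewrite /f /= eqx => /mulgI/mulIg/mulgI -> //.
have root x : x \in X -> e11 (k * x * k^-1)%g * (t - e11 (k * x * k^-1)%g) = 1.
  move=> xX; have [<- _] := Xt x xX.
  have := sl2P (k * x * k^-1)%g; rewrite (e21X x xX) mulr0 addr0 => <-.
  by rewrite -(trJ k x) /tr addrAC subrr add0r.
have two x y : x \in X -> y \in X ->
    e11 (k * x * k^-1)%g != e11 (k * y * k^-1)%g ->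
    e11 (k * x * k^-1)%g + e11 (k * y * k^-1)%g = t.
  move=> xX yX; rewrite -subr_eq0 => nxy; apply/eqP.
  rewrite -subr_eq0 -(mulrI_eq0 _ (mulfI nxy)); apply/eqP.
  by rewrite -[RHS](subrr 1) -{1}(root y yX) -(root x xX); ring.
apply: card_le2 => -[x1 w1] [x2 w2] [x3 w3]; rewrite !inE /=.
move=> /andP[/andP[x1X w1X] /eqP f1] /andP[/andP[x2X w2X] /eqP f2].
move=> /andP[/andP[x3X w3X] /eqP f3] n12 n23 n31.
have m12 : e11 (k * x1 * k^-1)%g != e11 (k * x2 * k^-1)%g.
  by apply: contra n12 => /eqP h; apply/eqP; apply: inj => //; rewrite f1 f2.
have m23 : e11 (k * x2 * k^-1)%g != e11 (k * x3 * k^-1)%g.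
  by apply: contra n23 => /eqP h; apply/eqP; apply: inj => //; rewrite f2 f3.
have m31 : e11 (k * x3 * k^-1)%g != e11 (k * x1 * k^-1)%g.
  by apply: contra n31 => /eqP h; apply/eqP; apply: inj => //; rewrite f3 f1.
have := two _ _ x1X x2X m12; rewrite -(two _ _ x2X x3X m23) addrC => /addrI h.
by rewrite h eqxx in m31.
Qed.

Definition pairing x (n u v : F) : F :=
  (e11 x - e22 x) * n + e21 x * u + e12 x * v.

Lemma share_nilpotent x y n u v :
    ~~ [&& n == 0, u == 0 & v == 0] -> n ^+ 2 + u * v = 0 ->
    pairing x n u v = 0 -> pairing y n u v = 0 ->
  share_line x y.
Proof.
rewrite /pairing => nz nil px py; apply/existsP.
have [v0 | v0] := eqVneq v 0.
  have n0 : n = 0.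
    by move: nil; rewrite v0 mulr0 addr0 => /eqP; rewrite expf_eq0 => /eqP.
  have u0 : u != 0 by move: nz; rewrite n0 v0 !eqxx andbT.
  move: px py; rewrite n0 v0 !mulr0 add0r !addr0 add0r.
  move=> /eqP; rewrite mulf_eq0 (negPf u0) orbF => ex.
  move=> /eqP; rewrite mulf_eq0 (negPf u0) orbF => ey.
  by exists None; rewrite !fixl_None ex.
have fixP z : pairing z n u v = 0 -> fixl z (Some (n / v)).
  rewrite fixl_Some -subr_eq0 => pz.
  have v2 : v ^+ 2 != 0 by rewrite expf_eq0.
  rewrite -(mulrI_eq0 _ (mulfI v2)); apply/eqP.
  transitivity (e21 z * (n ^+ 2 + u * v) - v * pairing z n u v).
    by rewrite /pairing; field.
  by rewrite nil pz !mulr0 subr0.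
by exists (Some (n / v)); rewrite !fixP.
Qed.

Lemma cross_parallel (p q r p' q' r' n u v : F) :
    p * n + q * u + r * v = 0 -> p' * n + q' * u + r' * v = 0 ->
    ~~ [&& q * r' - r * q' == 0, r * p' - p * r' == 0 & p * q' - q * p' == 0] ->
  exists s, [/\ n = s * (q * r' - r * q'), u = s * (r * p' - p * r')
              & v = s * (p * q' - q * p')].
Proof.
set cn := q * r' - _; set cu := r * p' - _; set cv := p * q' - _ => h h' nz.
have e3 : u * cn = n * cu.
  apply/eqP; rewrite -subr_eq0; apply/eqP.
  transitivity (r' * (p * n + q * u + r * v) - r * (p' * n + q' * u + r' * v)).
    by rewrite /cn /cu; ring.
  by rewrite h h' !mulr0 subr0.
have e2 : n * cv = v * cn.
  apply/eqP; rewrite -subr_eq0; apply/eqP.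
  transitivity (q' * (p * n + q * u + r * v) - q * (p' * n + q' * u + r' * v)).
    by rewrite /cn /cv; ring.
  by rewrite h h' !mulr0 subr0.
have e4 : v * cu = u * cv.
  apply/eqP; rewrite -subr_eq0; apply/eqP.
  transitivity (p' * (p * n + q * u + r * v) - p * (p' * n + q' * u + r' * v)).
    by rewrite /cu /cv; ring.
  by rewrite h h' !mulr0 subr0.
have [cn0|cn0] := eqVneq cn 0; last first.
  exists (n / cn); rewrite divfK //; split=> //; apply: (mulIf cn0).
    by rewrite e3; field.
  by rewrite -e2; field.
have [cu0|cu0] := eqVneq cu 0; last first.
  exists (u / cu); rewrite divfK //; split=> //; apply: (mulIf cu0).
    by rewrite -e3; field.
  by rewrite e4; field.
have cv0 : cv != 0 by move: nz; rewrite cn0 cu0 !eqxx.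
exists (v / cv); rewrite divfK //; split=> //; apply: (mulIf cv0).
  by rewrite e2; field.
by rewrite -e4; field.
Qed.

Lemma parallel3 (p q r p' q' r' : F) :
    ~~ [&& p == 0, q == 0 & r == 0] ->
    q * r' = r * q' -> r * p' = p * r' -> p * q' = q * p' ->
  exists b, [/\ p' = b * p, q' = b * q & r' = b * r].
Proof.
move=> nz c1 c2 c3; have [p0|p0] := eqVneq p 0; last first.
  by exists (p' / p); rewrite divfK //; split=> //; apply: (mulIf p0);
    rewrite [RHS]mulrAC divfK // [LHS]mulrC ?c3 -?c2 [LHS]mulrC.
have [q0|q0] := eqVneq q 0; last first.
  by exists (q' / q); rewrite divfK //; split=> //; apply: (mulIf q0);
    rewrite [RHS]mulrAC divfK // [LHS]mulrC ?c1 -?c3 [LHS]mulrC.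
have r0 : r != 0 by move: nz; rewrite p0 q0 !eqxx.
by exists (r' / r); rewrite divfK //; split=> //; apply: (mulIf r0);
  rewrite [RHS]mulrAC divfK // [LHS]mulrC -?c1 ?c2 [LHS]mulrC.
Qed.

(* The commutator of [g] and [h] in coordinates, up to sign; it vanishes exactly
   when [1], [g] and [h] are linearly dependent. *)
Definition cross1 g h := e21 g * e12 h - e12 g * e21 h.
Definition cross2 g h := e12 g * (e11 h - e22 h) - (e11 g - e22 g) * e12 h.
Definition cross3 g h := (e11 g - e22 g) * e21 h - e21 g * (e11 h - e22 h).
Definition cross_eq0 g h :=
  [&& cross1 g h == 0, cross2 g h == 0 & cross3 g h == 0].

Lemma pairing_crossl g h :
  pairing g (cross1 g h) (cross2 g h) (cross3 g h) = 0.
Proof. by rewrite /pairing /cross1 /cross2 /cross3; ring. Qed.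

(* [y^-1] solves the linear equations [tr Y = tr (g Y) = tr (Y h) = t], whose
   solutions form a line of direction [cross g h], and [det Y = 1]. *)
Lemma fiber_line g h y y' (t : F) :
    tr y = t -> tr y' = t -> tr (g * y^-1)%g = tr (g * y'^-1)%g ->
    tr (y^-1 * h)%g = tr (y'^-1 * h)%g -> ~~ cross_eq0 g h ->
  exists s, [/\ e22 y' = e22 y + s * cross1 g h, e11 y' = e11 y - s * cross1 g h,
    e12 y' = e12 y - s * cross2 g h, e21 y' = e21 y - s * cross3 g h
    & s * pairing y (cross1 g h) (cross2 g h) (cross3 g h) =
      s * (s * (cross1 g h ^+ 2 + cross2 g h * cross3 g h))].
Proof.
move=> ty ty' tgy tyh nz; have yGP := sl2P y; have y'GP := sl2P y'.
have ty11 : e11 y' = e11 y + e22 y - e22 y'.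
  by rewrite -[e11 y + e22 y]/(tr y) ty -ty' /tr addrK.
have [|||s [hn hu hv]] := @cross_parallel (e11 g - e22 g) (e21 g) (e12 g)
   (e11 h - e22 h) (e21 h) (e12 h)
   (e22 y' - e22 y) (e12 y - e12 y') (e21 y - e21 y').
- apply: etrans (subrr (tr (g * y^-1)%g)); rewrite {1}tgy /tr !eM !e11V !e12V.
  by rewrite !e21V !e22V ty11; ring.
- apply: etrans (subrr (tr (y^-1 * h)%g)); rewrite {1}tyh /tr !eM !e11V !e12V.
  by rewrite !e21V !e22V ty11; ring.
- exact: nz.
rewrite -/(cross1 g h) -/(cross2 g h) -/(cross3 g h) in hn hu hv.
have y22 : e22 y' = e22 y + s * cross1 g h by rewrite -hn; ring.
have y11 : e11 y' = e11 y - s * cross1 g h by rewrite -hn ty11; ring.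
have y12 : e12 y' = e12 y - s * cross2 g h by rewrite -hu; ring.
have y21 : e21 y' = e21 y - s * cross3 g h by rewrite -hv; ring.
exists s; split=> //.
move: y'GP; rewrite y11 y22 y12 y21 => y'GP.
apply/eqP; rewrite -subr_eq0; apply/eqP; rewrite /pairing.
move: (cross1 g h) (cross2 g h) (cross3 g h) y'GP => cn cu cv y'GP.
transitivity (((e11 y - s * cn) * (e22 y + s * cn) -
    (1 + (e12 y - s * cu) * (e21 y - s * cv))) -
  (e11 y * e22 y - (1 + e12 y * e21 y))); first by ring.
by rewrite y'GP yGP !subrr.
Qed.

Lemma fiber_le2 g h y y' y'' (t : F) :
    tr y = t -> tr y' = t -> tr y'' = t ->
    tr (g * y^-1)%g = tr (g * y'^-1)%g -> tr (g * y^-1)%g = tr (g * y''^-1)%g ->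
    tr (y^-1 * h)%g = tr (y'^-1 * h)%g -> tr (y^-1 * h)%g = tr (y''^-1 * h)%g ->
    ~~ cross_eq0 g h -> ~~ share_line g y ->
  [\/ y = y', y = y'' | y' = y''].
Proof.
move=> ty ty' ty'' tgy' tgy'' tyh' tyh'' nz nsh.
have [s [a1 a2 a3 a4 a5]] := fiber_line ty ty' tgy' tyh' nz.
have [r [b1 b2 b3 b4 b5]] := fiber_line ty ty'' tgy'' tyh'' nz.
have [s0|s0] := eqVneq s 0.
  apply: Or31; apply: entriesP;
    by rewrite ?a1 ?a2 ?a3 ?a4 s0 mul0r ?addr0 ?subr0.
have [r0|r0] := eqVneq r 0.
  apply: Or32; apply: entriesP;
    by rewrite ?b1 ?b2 ?b3 ?b4 r0 mul0r ?addr0 ?subr0.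
have [sr|sr] := eqVneq s r.
  by apply: Or33; apply: entriesP; rewrite ?a1 ?a2 ?a3 ?a4 ?b1 ?b2 ?b3 ?b4 sr.
case/negP: nsh.
move/(mulfI s0): a5 => a5; move/(mulfI r0): b5 => b5.
have Q0 : cross1 g h ^+ 2 + cross2 g h * cross3 g h = 0.
  by apply/eqP; rewrite -(mulrI_eq0 _ (mulfI (_ : s - r != 0)))
     ?subr_eq0 // mulrBl -a5 -b5 subrr.
apply: (share_nilpotent nz Q0 (pairing_crossl g h)).
by rewrite a5 Q0 mulr0.
Qed.

Lemma dependent_triple x y z (t : F) :
    (2 : F) != 0 -> t != 0 ->
    tr x = t -> tr y = t -> tr z = t -> cross_eq0 (x * y)%g (y * z)%g ->
  [\/ y = x^-1%g, z = y^-1%g, z = (y^-1 * x * y)%g | share_line x y].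
Proof.
move=> F2 t0 tx ty tz c0.
set g := (x * y)%g in c0 *; set h := (y * z)%g in c0 *.
have xGP := sl2P x; have yGP := sl2P y.
have gGP := sl2P g; have hGP := sl2P h.
have [gsc|gns] := boolP [&& e11 g - e22 g == 0, e21 g == 0 & e12 g == 0].
  case/and3P: gsc; rewrite subr_eq0 => /eqP g11 /eqP g21 /eqP g12.
  have : (e22 g - 1) * (e22 g + 1) = 0.
    by move: gGP; rewrite g11 g12 g21 => gGP; ring: gGP.
  move/eqP; rewrite mulf_eq0 subr_eq0 addr_eq0 => /orP[]/eqP g22.
    apply: Or41; apply: (mulgI x); rewrite mulgV -/g.
    by apply: entriesP; rewrite e1 ?g11 ?g12 ?g21 ?g22.
  case/negP: t0; rewrite -(mulrI_eq0 _ (mulfI F2)).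
  have yE : y = (x^-1 * g)%g by rewrite mulKg.
  have : tr y = - t.
    rewrite yE /tr e11M e22M !eV g11 g12 g21 g22.
    by rewrite -tx /tr; ring.
  rewrite ty => /eqP; rewrite -subr_eq0 opprK => /eqP h0.
  by apply/eqP; rewrite -h0; ring.
case/and3P: c0 => /eqP c1 /eqP c2 /eqP c3.
have [b [h3 h2 h1]] : exists b, [/\ e11 h - e22 h = b * (e11 g - e22 g),
    e21 h = b * e21 g & e12 h = b * e12 g].
  move: c1 c2 c3; rewrite /cross1 /cross2 /cross3 => /eqP + /eqP + /eqP.
  by rewrite !subr_eq0 => /eqP c1 /eqP c2 /eqP c3; apply: parallel3.
set a := e22 h - b * e22 g.
have h22 : e22 h = a + b * e22 g by rewrite /a; ring.
have h11 : e11 h = a + b * e11 g by rewrite -[LHS](subrK (e22 h)) h3 h22; ring.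
have ab : a = 1 - b.
  have : tr z = (a + b) * t.
    have -> : z = (y^-1 * h)%g by rewrite mulKg.
    rewrite /tr e11M e22M !eV h11 h22 h1 h2.
    rewrite mulrDl -{1}ty -tx /tr /g !eM.
    ring: yGP.
  by rewrite tz -{1}[t]mul1r => /(mulIf t0) ->; rewrite addrK.
have : b * (b - 1) * (2 - tr g) = 0.
  move: hGP; rewrite h11 h22 h1 h2 ab /tr => hGP.
  have -> : b * (b - 1) * (2 - (e11 g + e22 g)) =
     (1 - b + b * e11 g) * (1 - b + b * e22 g) - (1 + b * e12 g * (b * e21 g)) -
     b ^+ 2 * (e11 g * e22 g - (1 + e12 g * e21 g)) by ring.
  by rewrite hGP gGP !subrr mulr0 subr0.
move/eqP; rewrite !mulf_eq0 -orbA.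
case/or3P=> [/eqP b0|b1|tg].
- apply: Or42; apply: (mulgI y); rewrite mulgV -/h.
  by apply: entriesP; rewrite e1 ?h11 ?h22 ?h1 ?h2 ?ab ?b0; ring.
- apply: Or43; apply: (mulgI y); rewrite -/h !mulgA mulgV mul1g -/g.
  move: b1; rewrite subr_eq0 => /eqP b1.
  by apply: entriesP; rewrite ?h11 ?h22 ?h1 ?h2 ?ab ?b1; ring.
have [n0|n0] := boolP [&& e11 x - e22 y == 0, e12 x + e12 y == 0
   & e21 x + e21 y == 0].
  case/and3P: n0; rewrite subr_eq0 !addr_eq0 => /eqP n1 /eqP n2 /eqP n3.
  have n4 : e22 x = e11 y.
    by apply: (addrI (e11 x)); rewrite -/(tr x) tx -ty n1 addrC.
  apply: Or41; apply: (mulgI x); rewrite mulgV.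
  by apply: entriesP; rewrite e1 eM ?n1 ?n2 ?n3 ?n4; ring: yGP.
have T0 : e11 x + e22 x - (e11 y + e22 y) = 0.
  by rewrite -/(tr x) -/(tr y) tx ty subrr.
have S2 : e11 x * e11 y + e12 x * e21 y + e21 x * e12 y + e22 x * e22 y = 2.
  by rewrite -addrA; apply/esym/eqP; rewrite -subr_eq0.
have dx : e11 x * e22 x - e12 x * e21 x = 1 by rewrite xGP addrK.
have dy : e11 y * e22 y - e12 y * e21 y = 1 by rewrite yGP addrK.
move: T0 S2 dx dy; set T := _ - _; set S := _ + _; set Dx := _ - _.
set Dy := _ - _ => T0 S2 dx dy.
apply: Or44; apply: (share_nilpotent n0); rewrite /pairing.
- transitivity (S - Dx - Dy + (e11 x - e22 y) * T).
    by rewrite /S /Dx /Dy /T; ring.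
  by rewrite T0 S2 dx dy; ring.
- transitivity (S - Dx - Dx + e11 x * T).
    by rewrite /S /Dx /T; ring.
  by rewrite T0 S2 dx; ring.
- transitivity (S - Dy - Dy - e22 y * T).
    by rewrite /S /Dy /T; ring.
  by rewrite T0 S2 dy; ring.
Qed.

End Fibers.

Section TraceClasses.
Variable F : finFieldType.
Implicit Types (x y z g h : sl2 F) (A B X : {set sl2 F}).

Lemma card_share X N : (forall x, x \in X -> tr x != 2 /\ tr x != -2) ->
    (forall l, #|[set x in X | fixl x l]| <= N)%N ->
  (#|[set u in setX X X | share_line u.1 u.2]| <= 2 * N * #|X|)%N.
Proof.
move=> Xt XN; set S := finset _.
have fib (s : sl2 F * sl2 F) : s \in S ->
    (#|[set u in S | u.2 == s.2]| <= 2 * N)%N.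
  case: s => x0 y; rewrite inE /= => /andP[]; rewrite inE /= => /andP[_ yX] _.
  have [y2 ym2] := Xt y yX.
  apply: (@leq_trans #|\bigcup_(l in [set l | fixl y l]) [set x in X | fixl x l]|).
    rewrite -(@card_in_imset _ _ fst); last first.
      move=> [x z] [x' z'] /setIdP[_ /eqP /= ->] /setIdP[_ /eqP /= ->].
      by move=> /= ->.
    apply/subset_leq_card/subsetP => _ /imsetP[[x z] /setIdP[+ /eqP /= zy] ->].
    rewrite zy => /setIdP[/setXP[xX _] /existsP[l /andP[fx fy]]].
    by apply/bigcupP; exists l; rewrite !inE ?xX.
  apply: leq_trans (card_bigcup_le _ _) _ => //.
  apply: (@leq_trans (\sum_(l in [set l | fixl y l]) N)).
    by apply: leq_sum.
  by rewrite sum_nat_const leq_mul2r card_fixl ?orbT.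
apply: leq_trans (card_le_fiber fib) _; rewrite leq_mul2l subset_leq_card ?orbT //.
by apply/subsetP => _ /imsetP[[x y] /setIdP[/setXP[_ yX] _] ->].
Qed.

Lemma card_trace_class X N (t : F) :
    (2 : F) != 0 -> [&& t != 0, t != 2 & t != -2] ->
    (forall x, x \in X -> tr x = t) ->
    (forall l, #|[set x in X | fixl x l]| <= N)%N ->
  (#|X| ^ 3 <= 2 * #|(X * X)%g| ^ 2 + #|X| ^ 2 * (2 * N + 3))%N.
Proof.
move=> F2 /and3P[t0 t2 tm2] Xt XN.
set X3 := setX X (setX X X).
pose f (u : sl2 F * (sl2 F * sl2 F)) := ((u.1 * u.2.1)%g, (u.2.1 * u.2.2)%g).
pose good (u : sl2 F * (sl2 F * sl2 F)) :=
  ~~ cross_eq0 (u.1 * u.2.1)%g (u.2.1 * u.2.2)%g && ~~ share_line u.1 u.2.1.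
have X3P x y z : (x, (y, z)) \in X3 -> [/\ x \in X, y \in X & z \in X].
  by case/setXP => ? /setXP[].
have cX3 : (#|X3| = #|X| ^ 3)%N by rewrite !cardsX !expnS expn0 muln1.
rewrite -cX3 -(cardsID [set u | good u] X3).
apply: leq_add.
  apply: (@leq_trans (2 * #|f @: (X3 :&: [set u | good u])|)).
    apply: card_le_fiber => s _; apply: card_le2.
    move=> [x [y z]] [x' [y' z']] [x'' [y'' z'']].
    move=> /setIdP[/setIP[/X3P[xX yX zX]]]; rewrite inE => /andP[/= nz nsh] /eqP fs.
    move=> /setIdP[/setIP[/X3P[x'X y'X z'X]]]; rewrite inE => /andP[/= nz' nsh'] /eqP fs'.
    move=> /setIdP[/setIP[/X3P[x''X y''X z''X]]]; rewrite inE => /andP[/= nz'' nsh''] /eqP fs''.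
    have inj u v : f u = f v -> u.2.1 = v.2.1 -> u = v.
      case: u v => [u1 [u2 u3]] [v1 [v2 v3]] e /= e2; rewrite {}e2 in e *.
      have /= /mulIg -> := congr1 fst e.
      by have /= /mulgI -> := congr1 snd e.
    have nsg : ~~ share_line (x * y)%g y.
      apply: contra nsh => /existsP[l /andP[fg fy]]; apply/existsP; exists l.
      by rewrite fy andbT -(mulgK y x) fixlM ?fixlV.
    have eq1 : f (x, (y, z)) = f (x', (y', z')) by rewrite fs fs'.
    have eq2 : f (x, (y, z)) = f (x'', (y'', z'')) by rewrite fs fs''.
    have /= g1 := congr1 fst eq1; have /= h1 := congr1 snd eq1.
    have /= g2 := congr1 fst eq2; have /= h2 := congr1 snd eq2.
    have [] := @fiber_le2 F _ _ y y' y'' t (Xt _ yX) (Xt _ y'X) (Xt _ y''X)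
      _ _ _ _ nz nsg.
    + by rewrite {2}g1 !mulgK !Xt.
    + by rewrite {2}g2 !mulgK !Xt.
    + by rewrite {2}h1 !mulKg !Xt.
    + by rewrite {2}h2 !mulKg !Xt.
    + by move=> yy; rewrite (inj _ _ eq1 yy) eqxx.
    + by move=> yy _ _; rewrite (inj _ _ eq2 yy) eqxx.
    + by move=> yy _; rewrite (inj _ _ (etrans (esym eq1) eq2) yy) eqxx.
  rewrite leq_mul2l /= -mulnn -cardsX subset_leq_card //.
  apply/subsetP => _ /imsetP[[x [y z]] /setIP[/X3P[xX yX zX] _] ->].
  by rewrite /f inE /= !mem_mulg.
set S := [set u in setX X X | share_line u.1 u.2].
pose B1 := [set (u.1, (u.1^-1%g, u.2)) | u in setX X X].
pose B2 := [set (u.1, (u.2, u.2^-1%g)) | u in setX X X].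
pose B3 := [set (u.1, (u.2, (u.2^-1 * u.1 * u.2)%g)) | u in setX X X].
pose B4 := [set (u.1.1, (u.1.2, u.2)) | u in setX S X].
have cB (f' : sl2 F * sl2 F -> sl2 F * (sl2 F * sl2 F)) :
    (#|f' @: setX X X| <= #|X| ^ 2)%N.
  by rewrite -mulnn -cardsX leq_imset_card.
have cB4 : (#|B4| <= #|X| ^ 2 * (2 * N))%N.
  apply: leq_trans (leq_imset_card _ _) _; rewrite cardsX -mulnn.
  apply: leq_trans (leq_mul (card_share _ XN) (leqnn _)) _.
    by move=> x xX; rewrite Xt.
  by rewrite -mulnA mulnC.
apply: (@leq_trans #|B1 :|: B2 :|: (B3 :|: B4)|); last first.
  apply: leq_trans (leq_card_setU _ _) _.
  have := leq_of_leqif (leq_card_setU B1 B2).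
  have := leq_of_leqif (leq_card_setU B3 B4).
  have cB1 : (#|B1| <= #|X| ^ 2)%N by apply: cB.
  have cB2 : (#|B2| <= #|X| ^ 2)%N by apply: cB.
  have cB3 : (#|B3| <= #|X| ^ 2)%N by apply: cB.
  move: cB1 cB2 cB3 cB4; move: #|_ :|: _| #|_ :|: _| #|B1| #|B2| #|B3| #|B4|.
  by rewrite mulnDr; move: (#|X| ^ 2 * (2 * N))%N (#|X| ^ 2)%N; lia.
apply/subset_leq_card/subsetP => -[x [y z]] /setDP[/X3P[xX yX zX]].
rewrite !inE /good /= negb_and !negbK => /orP[c0|sh]; last first.
  apply/orP; right; apply/orP; right; apply/imsetP; exists ((x, y), z) => //.
  by rewrite !inE /= xX yX zX sh.
have [] := dependent_triple F2 t0 (Xt _ xX) (Xt _ yX) (Xt _ zX) c0.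
- move=> yE; apply/orP; left; apply/orP; left; apply/imsetP; exists (x, z).
    by rewrite inE /= xX.
  by rewrite yE.
- move=> zE; apply/orP; left; apply/orP; right; apply/imsetP; exists (x, y).
    by rewrite inE /= xX.
  by rewrite zE.
- move=> zE; apply/orP; right; apply/orP; left; apply/imsetP; exists (x, y).
    by rewrite inE /= xX.
  by rewrite zE.
- move=> sh; apply/orP; right; apply/orP; right; apply/imsetP.
  by exists ((x, y), z); rewrite // !inE /= xX yX zX sh.
Qed.

Lemma generators_move A l : 1%g \in A -> <<A>>%g = [set: sl2 F] ->
  exists2 a, a \in A & ~~ fixl a l.
Proof.
move=> A1 genA; have [n An] := expgs_full A1.
apply/exists_inP; rewrite -[X in is_true X]negbK negb_exists_in.
apply/negP => /forall_inP fixA.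
have {fixA} fixn m x : x \in (A ^+ m)%g -> fixl x l.
  elim: m x => [|m IHm] x.
    rewrite expg0 inE => /eqP ->.
    by rewrite /fixl mulg1 mulgV e21_1.
  rewrite expgS => /mulsgP[a b aA bA ->]; apply: fixlM; last exact: IHm.
  by have := fixA a aA; rewrite negbK.
have fixT x : fixl x l by apply: (fixn n); rewrite An genA inE.
case: l fixn fixT => [s|] _ fixT.
  have [x [h1 h2 h3 h4]] : exists x : sl2 F,
    [/\ e11 x = 1, e12 x = 1, e21 x = 0 & e22 x = 1] by apply: sl2_ex; ring.
  have := fixT x; rewrite fixl_Some h1 h2 h3 h4 subrr !mul0r addr0.
  by rewrite eq_sym oner_eq0.
have [x [h1 h2 h3 h4]] : exists x : sl2 F,
  [/\ e11 x = 1, e12 x = 0, e21 x = 1 & e22 x = 1] by apply: sl2_ex; ring.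
by have := fixT x; rewrite fixl_None h3 oner_eq0.
Qed.

Lemma card_trace_expgs A j (t : F) :
    (2 : F) != 0 -> [&& t != 0, t != 2 & t != -2] ->
    1%g \in A -> (A^-1 = A)%g -> <<A>>%g = [set: sl2 F] ->
  (#|[set x in (A ^+ j)%g | tr x == t]| ^ 3 <=
   4000 * #|(A ^+ (2 * j + 2))%g| ^ 2)%N.
Proof.
move=> F2 tt A1 AV genA; set X := finset _; set K := #|(A ^+ _)%g|.
pose N := \max_(l : option F) #|[set x in X | fixl x l]|.
have XA x : x \in X -> x \in (A ^+ j)%g by case/setIdP.
have K0 : (0 < K)%N.
  by rewrite /K card_gt0; apply/set0Pn; exists 1%g; apply: expgs_mem1.
have N2 : (N ^ 2 <= 2 * K)%N.
  have [l ->] : exists l, N = #|[set x in X | fixl x l]|.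
    have [|l Nl] := @bigop.eq_bigmax _ (fun l : option F => #|[set x in X | fixl x l]|).
      by rewrite card_option.
    by exists l.
  have [a aA al] := generators_move l A1 genA.
  apply: leq_trans (@card_line F _ a l t al _) _.
    by move=> x /setIdP[/setIdP[_ /eqP]].
  rewrite leq_mul2l /=; apply/subset_leq_card/subsetP => u.
  case/imset2P => x w /setIdP[/XA xA _] /setIdP[/XA wA _] ->.
  apply: (@mem_expgsW _ A (j + (1 + j + 1))%N) => //; first by lia.
  by apply: mem_expgsM => //; apply: mem_expgsJ; rewrite ?expg1.
have XX : (#|(X * X)%g| <= K)%N.
  apply/subset_leq_card/subsetP => _ /mulsgP[x y /XA xA /XA yA ->].
  by apply: (@mem_expgsW _ A (j + j)%N) => //; [lia | apply: mem_expgsM].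
have := @card_trace_class X N t F2 tt.
have Xt x : x \in X -> tr x = t by move=> /setIdP[_ /eqP].
have XN l : (#|[set x in X | fixl x l]| <= N)%N by apply: bigop.leq_bigmax.
move=> /(_ Xt XN).
clear Xt XN XA; move: XX N2 K0; move: #|X| #|(X * X)%g| N K => x w N K wK N2 K0 h.
have w2 : (w ^ 2 <= K ^ 2)%N by rewrite leq_sqr.
have [xN|xN] := leqP (4 * N + 6) x.
  have : (x ^ 2 * (4 * N + 6) <= x ^ 2 * x)%N by rewrite leq_mul2l xN orbT.
  by rewrite -expnSr; lia.
have [N0|N0] := posnP N.
  have x5 : (x <= 5)%N by lia.
  have : (x ^ 3 <= 5 ^ 3)%N by rewrite leq_exp2r.
  have : (1 <= K ^ 2)%N by rewrite expn_gt0 K0.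
  by lia.
have x10 : (x <= 10 * N)%N by lia.
have : (x ^ 3 <= (10 * N) ^ 3)%N by rewrite leq_exp2r.
have N2K : (N <= 2 * K)%N by apply: leq_trans N2; rewrite -mulnn leq_pmulr.
have : (N ^ 2 * N <= (2 * K) * (2 * K))%N by apply: leq_mul.
rewrite -expnSr expnMn; lia.
Qed.
End TraceClasses.

(** * Maximal tori and the pivot argument *)

Section Tori.
Variable F : finFieldType.
Implicit Types (x y z g h : sl2 F) (A B X : {set sl2 F}).

Lemma cent_coords g x : tr g != 2 -> tr g != -2 -> x \in 'C[g]%g ->
  exists a b, [/\ e11 x = a + b * e11 g, e12 x = b * e12 g,
                  e21 x = b * e21 g & e22 x = a + b * e22 g].
Proof.
move=> g2 gm2 /cent1P xg; have gP := sl2P g.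
have h11 := congr1 (@e11 F) xg; have h12 := congr1 (@e12 F) xg.
have h21 := congr1 (@e21 F) xg; rewrite !eM in h11 h12 h21.
have [||||b [b1 b2 b3]] := @parallel3 F (e11 g - e22 g) (e21 g) (e12 g)
    (e11 x - e22 x) (e21 x) (e12 x).
- apply/negP => /and3P[]; rewrite subr_eq0 => /eqP g11 /eqP g21 /eqP g12.
  have : (e11 g - 1) * (e11 g + 1) = 0 by rewrite -g11 g12 g21 in gP; ring: gP.
  move/eqP; rewrite mulf_eq0 subr_eq0 addr_eq0 => /orP[] /eqP e.
    by case/negP: g2; rewrite /tr -g11 e.
  by case/negP: gm2; rewrite /tr -g11 e; apply/eqP; ring.
- by rewrite mulrC; apply: (addrI (e11 x * e11 g)); rewrite h11; ring.
- apply/eqP; rewrite -subr_eq0; apply/eqP; apply: etrans (subrr (e11 x * e12 g + e12 x * e22 g)).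
  by rewrite {2}h12; ring.
- apply/eqP; rewrite -subr_eq0; apply/eqP; apply: etrans (subrr (e21 x * e11 g + e22 x * e21 g)).
  by rewrite {2}h21; ring.
exists (e22 x - b * e22 g), b; split=> //; last by rewrite subrK.
by rewrite -[LHS](subrK (e22 x)) b1; ring.
Qed.

Lemma cent_trace_card g (s : F) : (2 : F) != 0 -> tr g != 2 -> tr g != -2 ->
  (#|[set x in 'C[g]%g | tr x == s]| <= 2)%N.
Proof.
move=> F2 g2 gm2; have gP := sl2P g.
have coord x : x \in [set x in 'C[g]%g | tr x == s] -> exists a b,
   [/\ e11 x = a + b * e11 g, e12 x = b * e12 g,
       e21 x = b * e21 g & e22 x = a + b * e22 g] /\
   (2 * a = s - b * tr g /\ b ^+ 2 * (tr g ^+ 2 - 4) = s ^+ 2 - 4).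
  case/setIdP => xg /eqP <-; have [a [b [h1 h2 h3 h4]]] := cent_coords g2 gm2 xg.
  exists a, b; split=> //; have xP := sl2P x.
  rewrite h1 h2 h3 h4 in xP; split; first by rewrite /tr h1 h4; ring.
  have x1 : (a + b * e11 g) * (a + b * e22 g) - b * e12 g * (b * e21 g) = 1.
    by rewrite xP addrK.
  have g1 : e11 g * e22 g - e12 g * e21 g = 1 by rewrite gP addrK.
  rewrite -[X in _ = _ - X]mulr1 -{2}x1 -[X in _ ^+ 2 - X]mulr1 -[X in 4 * X]g1.
  by rewrite /tr h1 h4; ring.
have t4 : tr g ^+ 2 - 4 != 0.
  have -> : tr g ^+ 2 - 4 = (tr g - 2) * (tr g + 2) by ring.
  by rewrite mulf_eq0 negb_or subr_eq0 g2 addr_eq0.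
apply: card_le2 => x y z /coord[a [b [[x1 x2 x3 x4] [xa xb]]]].
move=> /coord[a' [b' [[y1 y2 y3 y4] [ya yb]]]].
move=> /coord[a'' [b'' [[z1 z2 z3 z4] [za zb]]]].
have sq (u v : F) : u ^+ 2 * (tr g ^+ 2 - 4) = v ^+ 2 * (tr g ^+ 2 - 4) ->
  u != v -> u = - v.
  by move/(mulIf t4)/eqP; rewrite eqf_sqr => /orP[->//|/eqP].
have [e|nbb'] := eqVneq b b'.
  case/eqP; have ea : a = a' by apply: (mulfI F2); rewrite xa ya e.
  by apply: entriesP; rewrite ?x1 ?x2 ?x3 ?x4 e ?ea.
have [e|nb'b''] := eqVneq b' b''.
  move=> _ /eqP[]; have ea : a' = a'' by apply: (mulfI F2); rewrite ya za e.
  by apply: entriesP; rewrite ?y1 ?y2 ?y3 ?y4 e ?ea.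
have e : b'' = b.
  by rewrite [RHS](sq b b') ?xb ?yb // (sq b' b'') ?yb ?zb // opprK.
move=> _ _ /eqP[]; have ea : a'' = a by apply: (mulfI F2); rewrite za xa e.
by apply: entriesP; rewrite ?z1 ?z2 ?z3 ?z4 e ?ea.
Qed.

Definition regular x : bool := [&& tr x != 0, tr x != 2 & tr x != -2].

Lemma regularJ h x : regular (h * x * h^-1)%g = regular x.
Proof. by rewrite /regular trJ. Qed.

Lemma card_cent g : (2 : F) != 0 -> regular g -> (#|'C[g]%g| <= 2 * #|F|)%N.
Proof.
move=> F2 /and3P[_ g2 gm2].
apply: leq_trans (card_le_fiber (f := @tr F) (k := 2) _) _.
  by move=> s _; apply: cent_trace_card.
by rewrite leq_mul2l max_card.
Qed.

Lemma card_cent_irregular g : (2 : F) != 0 -> regular g ->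
  (#|[set x in 'C[g]%g | ~~ regular x]| <= 6)%N.
Proof.
move=> F2 /and3P[_ g2 gm2].
pose T s := [set x in 'C[g]%g | tr x == s].
apply: (@leq_trans #|T 0 :|: (T 2 :|: T (-2))|).
  apply/subset_leq_card/subsetP => x /setIdP[xC].
  have xT s : tr x == s -> x \in T s by move=> xs; apply/setIdP.
  by rewrite /regular !negb_and !negbK !in_setU => /or3P[]/xT ->; rewrite ?orbT.
apply: leq_trans (leq_of_leqif (leq_card_setU _ _)) _.
apply: (@leq_trans (2 + (2 + 2))) => //; rewrite leq_add //.
  exact: cent_trace_card.
apply: leq_trans (leq_of_leqif (leq_card_setU _ _)) _.
by rewrite leq_add //; apply: cent_trace_card.
Qed.

Lemma cent_regular_sub g x : regular x -> x \in 'C[g]%g -> 'C[x]%g \subset 'C[g]%g.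
Proof.
move=> /and3P[_ x2 xm2] xg; apply/subsetP => y yx.
have gx : g \in 'C[x]%g by rewrite cent1C.
have [a [b [h1 h2 h3 h4]]] := cent_coords x2 xm2 gx.
have [c [d [k1 k2 k3 k4]]] := cent_coords x2 xm2 yx.
by apply/cent1P; apply: entriesP; rewrite !eM ?h1 ?h2 ?h3 ?h4 ?k1 ?k2 ?k3 ?k4; ring.
Qed.

Lemma card_sl2_ge : (#|F| ^ 2 * #|F|.-1 <= #|[set: sl2 F]|)%N.
Proof.
pose f x := (e11 x, (e12 x, e21 x)).
pose S : {set F * (F * F)} := setX [set~ 0] [set: F * F].
have <- : #|S| = (#|F| ^ 2 * #|F|.-1)%N.
  by rewrite cardsX cardsC1 cardsT card_prod mulnn mulnC.
apply: leq_trans (leq_imset_card f _); apply/subset_leq_card/subsetP.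
move=> [a [b c]]; rewrite !inE andbT => /= a0; apply/imsetP.
have [|x [h1 h2 h3 h4]] := @sl2_ex F a b c ((1 + b * c) / a).
  by rewrite mulrC divfK.
by exists x; rewrite ?in_setT // /f h1 h2 h3.
Qed.

Lemma card_cent_expgs A m g : (2 : F) != 0 -> regular g ->
    1%g \in A -> (A^-1 = A)%g -> <<A>>%g = [set: sl2 F] -> g \in (A ^+ m)%g ->
  (#|A| ^ 3 <= 4000 * #|(A ^+ (2 * m + 6))%g| ^ 2 *
     #|(A ^+ 2 :&: 'C[g])%g| ^ 3)%N.
Proof.
move=> F2 rg A1 AV genA gA.
have := card_conj_cent g AV.
set L := #|_ :&: _|; set Cl := [set _ | _ in _] => h.
have hCl : (#|Cl| <= #|[set x in (A ^+ (m + 2))%g | tr x == tr g]|)%N.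
  apply/subset_leq_card/subsetP => _ /imsetP[a aA ->].
  rewrite inE trJ eqxx andbT; apply: (@mem_expgsW _ A (1 + m + 1)%N) => //.
    by lia.
  by apply: mem_expgsJ; rewrite ?expg1.
have := card_trace_expgs (m + 2) F2 rg A1 AV genA.
have -> : (2 * (m + 2) + 2 = 2 * m + 6)%N by lia.
move=> hX; apply: (@leq_trans ((L * #|Cl|) ^ 3)); first by rewrite leq_exp2r.
rewrite expnMn mulnC leq_mul2r; apply/orP; right.
by apply: leq_trans hX; rewrite leq_exp2r.
Qed.

(* The pivot argument: if every regular element of [A ^+ m] has a large
   centralizer in [A ^+ 2], then having many elements of [A ^+ 2] is a property
   of the maximal torus ['C[g0]] which is inherited by its conjugates under [A],
   hence under the whole group, and distinct conjugates have no regular element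
   in common. *)
Lemma pivot A m L g0 : (2 : F) != 0 ->
    1%g \in A -> (A^-1 = A)%g -> <<A>>%g = [set: sl2 F] ->
    (4 <= m)%N -> g0 \in (A ^+ m)%g -> regular g0 -> (6 < L)%N ->
    (forall g, g \in (A ^+ m)%g -> regular g ->
       (L <= #|(A ^+ 2 :&: 'C[g])%g|)%N) ->
  (#|[set: sl2 F]| * (L - 6) <= #|(A ^+ 2)%g| * (4 * #|F|))%N.
Proof.
move=> F2 A1 AV genA m4 g0A rg0 L6 hL.
pose R h := [set x in (A ^+ 2)%g | (x \in 'C[h * g0 * h^-1]%g) && regular x].
have cardR g : regular g -> (L <= #|(A ^+ 2 :&: 'C[g])%g|)%N ->
    (L - 6 <= #|[set x in (A ^+ 2)%g | (x \in 'C[g]%g) && regular x]|)%N.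
  move=> rg hLg; set S := finset _.
  have sub : (A ^+ 2 :&: 'C[g])%g \subset S :|: [set x in 'C[g]%g | ~~ regular x].
    apply/subsetP => x /setIP[xA xg]; rewrite in_setU.
    have [rx|nrx] := boolP (regular x); apply/orP; [left|right].
      by apply/setIdP; split=> //; apply/andP.
    by apply/setIdP.
  have := leq_trans hLg (subset_leq_card sub).
  have := leq_of_leqif (leq_card_setU S [set x in 'C[g]%g | ~~ regular x]).
  have := card_cent_irregular F2 rg.
  by move: #|_ :|: _| #|S| #|_|; lia.
have exR g : regular g -> (L <= #|(A ^+ 2 :&: 'C[g])%g|)%N ->
    exists x, [/\ x \in (A ^+ 2)%g, x \in 'C[g]%g & regular x].
  move=> rg /(cardR g rg) h.
  have : (0 < #|[set x in (A ^+ 2)%g | (x \in 'C[g]%g) && regular x]|)%N.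
    by apply: leq_trans h; rewrite subn_gt0.
  by rewrite card_gt0 => /set0Pn[x /setIdP[xA /andP[xg rx]]]; exists x.
have conj_invol n h : h \in (A ^+ n)%g ->
    (L <= #|(A ^+ 2 :&: 'C[h * g0 * h^-1])%g|)%N.
  elim: n h => [|n IHn] h.
    by rewrite expg0 inE => /eqP ->; rewrite mul1g invg1 mulg1; apply: hL.
  rewrite expgS => /mulsgP[a h' aA h'A ->].
  have [|x [xA xC rx]] := exR (h' * g0 * h'^-1)%g _ (IHn _ h'A).
    by rewrite regularJ.
  have rax : regular (a * x * a^-1)%g by rewrite regularJ.
  have axA : (a * x * a^-1)%g \in (A ^+ m)%g.
    apply: (@mem_expgsW _ A (1 + 2 + 1)%N) => //.
    by apply: mem_expgsJ; rewrite ?expg1.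
  apply: leq_trans (hL _ axA rax) _; apply: subset_leq_card.
  apply: setIS; apply: cent_regular_sub => //.
  have -> : (a * h' * g0 * (a * h')^-1 = a * (h' * g0 * h'^-1) * a^-1)%g.
    by rewrite invMg !mulgA.
  by apply/cent1P; rewrite /commute -!conj_mul (cent1P xC).
have [n An] := expgs_full A1; rewrite genA in An.
have hR h : (L - 6 <= #|R h|)%N.
  apply: cardR; first by rewrite regularJ.
  by apply: (conj_invol n); rewrite An inE.
apply: (@leq_trans (\sum_(h in [set: sl2 F]) #|R h|)).
  by rewrite -sum_nat_const; apply: leq_sum.
under eq_bigr => h _ do rewrite -sum1_card (eq_bigl _ _ (fun x => in_set _ x)).
under eq_bigr => h _ do rewrite big_mkcondr.
rewrite exchange_big /= -sum_nat_const; apply: leq_sum => x xA.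
rewrite -big_mkcondr sum1dep_card.
have [rx|nrx] := boolP (regular x); last first.
  set S := finset _; suff -> : S = set0 by rewrite cards0.
  by apply/setP => h; rewrite !inE andbF.
have -> : (4 * #|F| = 2 * #|F| * 2)%N by lia.
apply: leq_trans (card_le_fiber (f := fun h => (h * g0 * h^-1)%g) (k := 2 * #|F|) _) _.
  move=> h0 _; apply: leq_trans (card_cent F2 rg0).
  rewrite -(card_imset _ (mulgI h0^-1)%g); apply/subset_leq_card/subsetP.
  move=> _ /imsetP[h /setIdP[_ /eqP hh] ->].
  apply/cent1P; apply: (mulgI h0); apply: (mulIg h^-1%g).
  by rewrite !mulgA mulgV mul1g hh mulgK.
rewrite leq_mul2l; apply/orP; right.
apply: leq_trans (cent_trace_card (tr g0) F2 _ _); last 2 first.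
- by case/and3P: rx => _ + _; apply.
- by case/and3P: rx => _ _; apply.
apply/subset_leq_card/subsetP => _ /imsetP[h /setIdP[_ + ] ->].
by case/andP=> xC _; apply/setIdP; rewrite trJ eqxx cent1C.
Qed.

End Tori.

(** * Existence of regular elements *)

Section RegularElements.
Variable F : finFieldType.
Implicit Types (x y z g h : sl2 F) (A B X : {set sl2 F}).

Fact sl2_minus_one_subproof : (-1 : F) * -1 == 1 + 0 * 0.
Proof. by rewrite mulrNN mulr1 mulr0 addr0. Qed.

Definition mone : sl2 F := @Sl2 F (-1, 0, 0, -1) sl2_minus_one_subproof.

Lemma moneE : [/\ e11 mone = -1, e12 mone = 0, e21 mone = 0 & e22 mone = -1].
Proof. by []. Qed.

Lemma mone_neq1 : (2 : F) != 0 -> mone != 1%g.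
Proof.
apply: contra => /eqP/(congr1 (@e11 F)); have [-> _ _ _] := moneE.
rewrite e11_1 => h; apply/eqP; rewrite -[2]/(1 + 1) -{1}h; ring.
Qed.

Lemma mone_mul x : [/\ e11 (mone * x)%g = - e11 x, e12 (mone * x)%g = - e12 x,
  e21 (mone * x)%g = - e21 x & e22 (mone * x)%g = - e22 x].
Proof. by have [h1 h2 h3 h4] := moneE; rewrite !eM h1 h2 h3 h4; split; ring. Qed.

Lemma monemone : (mone * mone)%g = 1%g.
Proof.
by have [h1 h2 h3 h4] := moneE; apply: entriesP;
  rewrite !eM ?h1 ?h2 ?h3 ?h4 e1; ring.
Qed.

Lemma moneC x : (mone * x = x * mone)%g.
Proof.
by have [h1 h2 h3 h4] := moneE; apply: entriesP;
  rewrite !eM ?h1 ?h2 ?h3 ?h4; ring.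
Qed.

Lemma trace0_inv x : tr x = 0 -> (x^-1 = mone * x)%g.
Proof.
move=> /eqP; rewrite /tr addr_eq0 => /eqP x11.
by have [h1 h2 h3 h4] := mone_mul x; apply: entriesP;
  rewrite ?h1 ?h2 ?h3 ?h4 !eV ?x11; ring.
Qed.

Lemma trace0_anticommute x y : tr x = 0 -> tr y = 0 -> tr (x * y)%g = 0 ->
  (x * y = mone * (y * x))%g.
Proof.
rewrite {3}/tr !eM => /eqP + /eqP; rewrite /tr !addr_eq0 => /eqP x11 /eqP y11 xy.
have [h1 h2 h3 h4] := mone_mul (y * x)%g.
apply: entriesP; rewrite ?h1 ?h2 ?h3 ?h4 !eM ?x11 ?y11; try ring;
  apply/eqP; rewrite -subr_eq0; apply/eqP; rewrite -[RHS]xy x11 y11; ring.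
Qed.

Definition is_scalar x := [&& e11 x - e22 x == 0, e21 x == 0 & e12 x == 0].

Lemma is_scalarP x : is_scalar x -> x = 1%g \/ x = mone.
Proof.
case/and3P; rewrite subr_eq0 => /eqP h1 /eqP h2 /eqP h3; have xP := sl2P x.
have : (e22 x - 1) * (e22 x + 1) = 0 by rewrite h1 h2 h3 in xP; ring: xP.
move/eqP; rewrite mulf_eq0 subr_eq0 addr_eq0 => /orP[]/eqP h4; [left|right].
  by apply: entriesP; rewrite e1 ?h1 ?h2 ?h3 ?h4.
by have [k1 k2 k3 k4] := moneE; apply: entriesP; rewrite ?k1 ?k2 ?k3 ?k4 ?h1 ?h2 ?h3 ?h4.
Qed.

Lemma multiple_neq_2_4 (s : F) : (2 : F) != 0 -> (3 : F) != 0 -> s != 0 ->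
  exists2 i : nat, (0 < i <= 3)%N & [&& i%:R * s != 0, i%:R * s != 2 & i%:R * s != 4].
Proof.
move=> F2 F3 s0; have F4 : (4 : F) != 0.
  have -> : 4 = 2 * 2 :> F by ring.
  by rewrite mulf_neq0.
have [s2|s2] := eqVneq s 2.
  have h1 : 3%:R * 2 - 2 = 4 :> F by ring.
  have h2 : 3%:R * 2 - 4 = 2 :> F by ring.
  exists 3%N => //; rewrite s2 mulf_neq0 //=; apply/andP; split.
    by rewrite -subr_eq0 h1.
  by rewrite -subr_eq0 h2.
have [s4|s4] := eqVneq s 4.
  have h1 : 2%:R * 4 - 2 = 2 * 3 :> F by ring.
  have h2 : 2%:R * 4 - 4 = 4 :> F by ring.
  exists 2%N => //; rewrite s4 mulf_neq0 //=; apply/andP; split.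
    by rewrite -subr_eq0 h1 mulf_neq0.
  by rewrite -subr_eq0 h2.
by exists 1%N => //; rewrite mul1r s0 s2 s4.
Qed.

(* Conjugating, [x = +-(1 b; 0 1)] and [a] has lower left entry [c <> 0]; the
   trace of [x^i * (a x a^-1)] is then [+-(2 - i (b c)^2)]. *)
Lemma regular_of_parabolic x a l (e : F) : (2 : F) != 0 -> (3 : F) != 0 ->
    e ^+ 2 = 1 -> tr x = 2 * e -> ~~ is_scalar x -> fixl x l -> ~~ fixl a l ->
  exists2 i : nat, (0 < i <= 3)%N & regular (x ^+ i * (a * x * a^-1))%g.
Proof.
move=> F2 F3 ee trx nsc fx fa; set k := to_inf l in fx fa.
pose x' := (k * x * k^-1)%g; pose a' := (k * a * k^-1)%g.
have x21 : e21 x' = 0 by apply/eqP.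
have a21 : e21 a' != 0 by [].
have trx' : tr x' = 2 * e by rewrite trJ.
have e0 : e != 0
  by apply/eqP => e0; move: ee; rewrite e0 expr0n /= => /eqP; rewrite eq_sym oner_eq0.
have x'P := sl2P x'; rewrite x21 mulr0 addr0 in x'P.
have x11 : e11 x' = e.
  have x22 : e22 x' = 2 * e - e11 x' by rewrite -trx' /tr; ring.
  have : (e11 x' - e) ^+ 2 = 0.
    rewrite x22 in x'P.
    transitivity (e ^+ 2 - e11 x' * (2 * e - e11 x')); first by ring.
    by rewrite x'P ee subrr.
  by move/eqP; rewrite expf_eq0 subr_eq0 => /eqP.
have x22 : e22 x' = e.
  by apply: (addrI (e11 x')); rewrite -/(tr x') trx' x11; ring.
have x12 : e12 x' != 0.
  apply: contra nsc => /eqP x12.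
  have xE : x = (k^-1 * x' * k)%g by rewrite /x' !mulgA mulVg mul1g mulgKV.
  rewrite xE; clearbody x' k; have kP := sl2P k.
  rewrite /is_scalar !eM !eV x11 x12 x21 x22.
  by apply/and3P; split; apply/eqP; ring.
have [|i i3 ireg] := @multiple_neq_2_4 ((e12 x' * e21 a') ^+ 2) F2 F3.
  by rewrite expf_eq0 mulf_neq0.
exists i => //; rewrite -(regularJ k) conj_mul conj_conj -/x' -/a'.
have -> : (k * x ^+ i * k^-1 = x' ^+ i)%g.
  elim: (i) => [|n IHn]; first by rewrite !expg0 mulg1 mulgV.
  by rewrite !expgS conj_mul IHn.
clearbody x' a'.
have xi n : [/\ e11 (x' ^+ n)%g = e ^+ n, e22 (x' ^+ n)%g = e ^+ n,
    e21 (x' ^+ n)%g = 0 & e * e12 (x' ^+ n)%g = n%:R * e ^+ n * e12 x'].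
  elim: n => [|n [h1 h2 h3 h4]]; first by rewrite expg0 !e1 !expr0; split=> //; ring.
  rewrite expgSr !eM h1 h2 h3 x11 x21 x22 !exprSr; split; try ring.
  rewrite mulrDr (mulrA e (e12 _)) h4 -natr1; ring.
have [h1 h2 h3 h4] := xi i.
have a'P := sl2P a'.
set y := (a' * x' * a'^-1)%g; set s := (e12 x' * e21 a') ^+ 2 in ireg.
have y21 : e21 y = - e12 x' * e21 a' ^+ 2.
  by rewrite /y !eM !eV x11 x21 x22; ring.
have try : tr y = 2 * e by rewrite trJ.
clearbody y; have trE : e * tr (x' ^+ i * y)%g = e ^+ i * (2 - i%:R * s).
  have -> : tr (x' ^+ i * y)%g = e ^+ i * tr y + e12 (x' ^+ i)%g * e21 y.
    by rewrite /tr !(e11M, e22M) h1 h2 h3; ring.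
  rewrite mulrDr mulrA mulrA h4 y21 try /s.
  transitivity (e ^+ i * (2 * e ^+ 2 - i%:R * (e12 x' * e21 a') ^+ 2)); first by ring.
  by rewrite ee mulr1.
have tr2 : tr (x' ^+ i * y)%g ^+ 2 = (2 - i%:R * s) ^+ 2.
  have pp : (e ^+ i) ^+ 2 = 1 by rewrite -exprM mulnC exprM ee expr1n.
  transitivity ((e * tr (x' ^+ i * y)%g) ^+ 2); first by rewrite exprMn ee mul1r.
  by rewrite trE exprMn pp mul1r.
case/and3P: ireg => i0 i2 i4.
have T4 : tr (x' ^+ i * y)%g ^+ 2 != 4.
  rewrite tr2 -subr_eq0.
  have -> : (2 - i%:R * s) ^+ 2 - 4 = i%:R * s * (i%:R * s - 4) by ring.
  by rewrite mulf_neq0 // subr_eq0.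
apply/and3P; split.
- apply: contra i2 => /eqP t0; move: tr2; rewrite t0 expr0n /= => /esym/eqP.
  by rewrite expf_eq0 /= subr_eq0 eq_sym.
- by apply: contra T4 => /eqP ->; apply/eqP; ring.
- by apply: contra T4 => /eqP ->; apply/eqP; ring.
Qed.

Lemma exists_regular A : (2 : F) != 0 -> (3 : F) != 0 ->
    1%g \in A -> (A^-1 = A)%g -> <<A>>%g = [set: sl2 F] -> (8 < #|A|)%N ->
  exists2 g, g \in (A ^+ 14)%g & regular g.
Proof.
move=> F2 F3 A1 AV genA A8.
apply/exists_inP; apply: contraT; rewrite negb_exists_in => /forall_inP nreg.
have AW m n x : (m <= n)%N -> x \in (A ^+ m)%g -> x \in (A ^+ n)%g.
  by move=> mn; apply: mem_expgsW.
have tr0 x : x \in (A ^+ 3)%g -> ~~ is_scalar x -> tr x = 0.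
  move=> xA nsc; apply/eqP; apply: contraT => t0.
  have x14 : x \in (A ^+ 14)%g by apply: AW xA.
  have := nreg x x14; rewrite /regular t0 /= negb_and !negbK => t2.
  have [e ee te] : exists2 e : F, e ^+ 2 = 1 & tr x = 2 * e.
    case/orP: t2 => /eqP ->; first by exists 1; rewrite ?expr1n ?mulr1.
    by exists (-1); ring.
  have xP := sl2P x.
  have x22 : e22 x = 2 * e - e11 x by rewrite -te /tr; ring.
  have nil : (e11 x - e) ^+ 2 + e12 x * e21 x = 0.
    rewrite x22 in xP.
    transitivity (e ^+ 2 - (1 + e12 x * e21 x) + 2 * (e12 x * e21 x)
       - (e11 x * (2 * e - e11 x) - e12 x * e21 x) + 1 - e12 x * e21 x ); first by ring.
    by rewrite xP ee; ring.
  have [l /andP[fx _]] : exists l, fixl x l && fixl x l.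
    apply/existsP; apply: (@share_nilpotent _ x x (e11 x - e) (e12 x) (e21 x)) => //.
    - apply: contra nsc => /and3P[]; rewrite subr_eq0 => /eqP h1 h2 h3.
      by rewrite /is_scalar h2 h3 x22 h1 !andbT; apply/eqP; ring.
    - rewrite /pairing x22.
      transitivity (2 * ((e11 x - e) ^+ 2 + e12 x * e21 x)); first by ring.
      by rewrite nil mulr0.
    - rewrite /pairing x22.
      transitivity (2 * ((e11 x - e) ^+ 2 + e12 x * e21 x)); first by ring.
      by rewrite nil mulr0.
  have [a aA fa] := generators_move l A1 genA.
  have [i i3 rg] := regular_of_parabolic F2 F3 ee te nsc fx fa.
  have : (x ^+ i * (a * x * a^-1))%g \in (A ^+ 14)%g.
    apply: (AW (3 * 3 + (1 + 3 + 1))%N) => //; apply: mem_expgsM.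
      have : (x ^+ i)%g \in (A ^+ (3 * i))%g.
        elim: (i) => [|n IHn]; first by rewrite muln0 !expg0 inE.
        by rewrite expgS mulnS mem_expgsM.
      by apply: AW; rewrite leq_mul2l; case/andP: i3.
    by apply: mem_expgsJ; rewrite ?expg1.
  by move/nreg; rewrite rg.
have nsc x : x != 1%g -> x != mone -> ~~ is_scalar x.
  by move=> x1 xm; apply/negP => /is_scalarP[] xE; rewrite xE eqxx in x1 xm.
have pick (s : seq (sl2 F)) : (size s <= 8)%N -> exists2 x, x \in A & x \notin s.
  move=> s8; apply/subsetPn; apply: contraL A8 => /subset_leq_card As.
  by rewrite -leqNgt (leq_trans As) // (leq_trans (card_size s)).
have [x xA] := pick [:: 1%g; mone] isT.
rewrite !inE !negb_or => /andP[x1 xm].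
have [y yA] := pick [:: 1%g; mone; x; (mone * x)%g] isT.
rewrite !inE !negb_or => /and4P[y1 ym yx ymx].
have [z zA] := pick [:: 1%g; mone; x; (mone * x)%g; y;
  (mone * y)%g; (x * y)%g; (mone * (x * y))%g] isT.
rewrite !inE !negb_or => /and5P[z1 zm zx zmx /and4P[zy zmy zxy zmxy]].
have A3 u : u \in A -> u \in (A ^+ 3)%g.
  by move=> uA; apply: (AW 1); rewrite ?expg1.
have A32 u v : u \in A -> v \in A -> (u * v)%g \in (A ^+ 3)%g.
  move=> uA vA; apply: (AW (1 + 1)%N) => //.
  by apply: mem_expgsM; rewrite expg1.
have tx : tr x = 0 := tr0 _ (A3 _ xA) (nsc _ x1 xm).
have ty : tr y = 0 := tr0 _ (A3 _ yA) (nsc _ y1 ym).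
have tz : tr z = 0 := tr0 _ (A3 _ zA) (nsc _ z1 zm).
(* As [tr u = 0], [u v] is central only if [v = +-u^-1 = -+u]. *)
have nscM u v : tr u = 0 -> v != u -> v != (mone * u)%g -> ~~ is_scalar (u * v)%g.
  move=> tu vu vmu; apply/negP => /is_scalarP[] uv.
    case/negP: vmu; apply/eqP; rewrite -trace0_inv //.
    by apply: (mulgI u); rewrite uv mulgV.
  case/negP: vu; apply/eqP; apply: (mulgI u); rewrite uv.
  rewrite -[mone]mulg1 -(mulgV u) (trace0_inv tu) (mulgA u) -(moneC u).
  by rewrite !mulgA monemone mul1g.
have txy := tr0 _ (A32 _ _ xA yA) (nscM _ _ tx yx ymx).
have txz := tr0 _ (A32 _ _ xA zA) (nscM _ _ tx zx zmx).
have tyz := tr0 _ (A32 _ _ yA zA) (nscM _ _ ty zy zmy).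
have txyz : tr (x * y * z)%g = 0.
  apply: tr0 (nscM _ _ txy zxy zmxy); apply: (AW (1 + 1 + 1)%N) => //.
  by rewrite mem_expgsM ?expg1 // mem_expgsM ?expg1.
have xyz := trace0_anticommute txy tz txyz.
have xz := trace0_anticommute tx tz txz.
have yz := trace0_anticommute ty tz tyz.
case/negP: (mone_neq1 F2); apply/eqP.
apply: (mulIg (z * (x * y))%g); rewrite -xyz mul1g -mulgA yz.
rewrite !mulgA -(moneC x) -(mulgA mone x z) xz !mulgA monemone mul1g.
by [].
Qed.

End RegularElements.

(** * Large sets *)

Section LargeSets.
Variable F : finFieldType.
Implicit Types (x y z g h : sl2 F) (A B X : {set sl2 F}).

Fact uni_subproof (e : F) : 1 * 1 == 1 + e * 0.
Proof. by rewrite mulr1 mulr0 addr0. Qed.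

Definition uni (e : F) : sl2 F := @Sl2 F (1, e, 0, 1) (uni_subproof e).

Lemma uniE e : [/\ e11 (uni e) = 1, e12 (uni e) = e, e21 (uni e) = 0
  & e22 (uni e) = 1].
Proof. by []. Qed.

Lemma uniD e e' : uni (e + e') = (uni e * uni e')%g.
Proof.
have [h1 h2 h3 h4] := uniE e; have [k1 k2 k3 k4] := uniE e'.
have [l1 l2 l3 l4] := uniE (e + e').
by apply: entriesP; rewrite !eM ?h1 ?h2 ?h3 ?h4 ?k1 ?k2 ?k3 ?k4 ?l1 ?l2 ?l3 ?l4; ring.
Qed.

Lemma uni_ex x : e11 x = 1 -> e21 x = 0 -> x = uni (e12 x).
Proof.
move=> h1 h3; have [k1 k2 k3 k4] := uniE (e12 x); have xP := sl2P x.
apply: entriesP; rewrite ?k1 ?k2 ?k3 ?k4 //.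
by rewrite h1 h3 mul1r mulr0 addr0 in xP.
Qed.

Lemma uni_in_expgs A : 1%g \in A -> (A^-1 = A)%g ->
    (8 * #|F| ^ 8 < #|A| ^ 3)%N ->
  forall e, uni e \in (A ^+ 16)%g.
Proof.
move=> A1 AV big; set q := #|F| in big.
have q0 : (0 < q)%N by apply/card_gt0P; exists 0.
have A0 : (0 < #|A|)%N by rewrite card_gt0; apply/set0Pn; exists 1%g.
have mem2 x y : x \in A -> y \in A -> (x^-1 * y)%g \in (A ^+ 2)%g.
  move=> xA yA; rewrite expgS expg1 mem_mulg //.
  by rewrite -AV inE invgK.
pose E := [set e | uni e \in (A ^+ 2)%g].
have AE : (#|A| <= #|E| * (q * q))%N.
  have [s sA] := card_big_fiber (fun x => (e11 x, e21 x)) A0.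
  rewrite card_prod => h; apply: leq_trans h _; rewrite leq_mul2r; apply/orP; right.
  set S := finset _.
  have SE x : x \in S -> (s^-1 * x)%g = uni (e12 (s^-1 * x)%g).
    case/setIdP=> xA /eqP[x1 x2]; have sP := sl2P s.
    by apply: uni_ex; rewrite eM !eV x1 x2; ring: sP.
  rewrite -(card_in_imset (f := fun x => e12 (s^-1 * x)%g) (D := mem S)).
    apply/subset_leq_card/subsetP => _ /imsetP[x xS ->]; rewrite inE -SE //.
    by apply: mem2 => //; case/setIdP: xS.
  move=> x y xS yS /= e; apply: (mulgI s^-1%g).
  by rewrite (SE x xS) (SE y yS) e.
pose B := [set b in (A ^+ 2)%g | e21 b == 0].
have AB : (#|A| <= #|B| * q.+1)%N.
  pose f x := if e21 x == 0 then None else Some (e11 x / e21 x).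
  have [s sA] := card_big_fiber f A0.
  rewrite card_option => h; apply: leq_trans h _; rewrite leq_mul2r; apply/orP; right.
  rewrite -(card_imset _ (mulgI s^-1)%g).
  apply/subset_leq_card/subsetP => _ /imsetP[x /setIdP[xA /eqP fxs] ->].
  rewrite inE mem2 //= eM !eV; move: fxs; rewrite /f.
  have [x0|x0] := eqVneq (e21 x) 0; have [s0|s0] := eqVneq (e21 s) 0 => //.
    by rewrite x0 s0 oppr0 mul0r mulr0 addr0.
  move=> [exs]; have -> : e11 x = e11 s / e21 s * e21 x by rewrite -exs divfK.
  by apply/eqP; field.
pose D := [set e11 b | b in B].
have BD : (#|B| <= q * #|D|)%N.
  apply: card_le_fiber => s /setIdP[_ /eqP s0].
  rewrite -(card_in_imset (f := @e12 F)) ?max_card // => x y.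
  case/setIdP=> /setIdP[_ /eqP x21] /eqP x11.
  case/setIdP=> /setIdP[_ /eqP y21] /eqP y11 xy12.
  have s11 : e11 s != 0.
    have := sl2P s; rewrite s0 mulr0 addr0 => h; apply/eqP => s11.
    by move: h; rewrite s11 mul0r => /esym/eqP; rewrite oner_eq0.
  apply: entriesP; rewrite ?x21 ?y21 ?x11 ?y11 //; apply: (mulfI s11).
  have := sl2P x; have := sl2P y.
  by rewrite x21 y21 x11 y11 !mulr0 !addr0 => -> ->.
pose Xi := [set d ^+ 2 | d in D].
have DXi : (#|D| <= 2 * #|Xi|)%N.
  apply: card_le_fiber => s _; apply: card_le2 => x y z.
  move=> /setIdP[_ /eqP xs] /setIdP[_ /eqP ys] /setIdP[_ /eqP zs] xy yz zx.
  have sq (u v : F) : u ^+ 2 = v ^+ 2 -> u != v -> u = - v.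
    by move/eqP; rewrite eqf_sqr => /orP[->|/eqP].
  have xy' := sq x y (etrans xs (esym ys)) xy.
  have yz' := sq y z (etrans ys (esym zs)) yz.
  by case/eqP: zx; rewrite xy' yz' opprK.
have bigXi : (2 * q ^ 2 < #|E| ^ 2 * #|Xi|)%N.
  have h1 : (#|A| ^ 2 <= (#|E| * (q * q)) ^ 2)%N by rewrite leq_sqr.
  have h2 : (#|A| <= 4 * q ^ 2 * #|Xi|)%N.
    apply: leq_trans AB _.
    apply: (@leq_trans (q * (2 * #|Xi|) * q.+1)).
      by rewrite leq_mul2r (leq_trans BD) ?orbT // leq_mul2l DXi orbT.
    have : (q * (2 * #|Xi|) * q.+1 <= q * (2 * #|Xi|) * (2 * q))%N.
      by rewrite leq_mul2l; apply/orP; right; lia.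
    by move=> h; apply: leq_trans h _; rewrite -mulnn; lia.
  have := leq_mul h1 h2; rewrite -expnSr => h3.
  have := leq_trans big h3.
  have -> : ((#|E| * (q * q)) ^ 2 * (4 * q ^ 2 * #|Xi|) =
    (4 * q ^ 6) * (#|E| ^ 2 * #|Xi|))%N by ring.
  have -> : (8 * q ^ 8 = (4 * q ^ 6) * (2 * q ^ 2))%N by ring.
  by rewrite ltn_mul2l; case/andP.
have [] := dilate_sumset _ bigXi.
  apply/negP => /imsetP[d /imsetP[b /setIdP[_ /eqP b21] ->]] /esym/eqP.
  rewrite expf_eq0 /= => /eqP b11; have := sl2P b.
  by rewrite b11 b21 mul0r mulr0 addr0 => /esym/eqP; rewrite oner_eq0.
move=> _ /imsetP[_ /imsetP[b /setIdP[bA /eqP b21] ->] ->] cover e.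
have [s [t [sS tS ->]]] := double_cover e cover.
have SA u : u \in [set e.1 + e11 b ^+ 2 * e.2 | e in setX E E] ->
    uni u \in (A ^+ (2 + (2 + 2 + 2)))%g.
  case/imsetP=> -[e1 e2]; rewrite !inE => /andP[/= e1E e2E] ->.
  rewrite uniD mem_expgsM //.
  have -> : uni (e11 b ^+ 2 * e2) = (b * uni e2 * b^-1)%g.
    have [h1 h2 h3 h4] := uniE e2.
    have [k1 k2 k3 k4] := uniE (e11 b ^+ 2 * e2); have bP := sl2P b.
    rewrite b21 mulr0 addr0 in bP.
    apply: entriesP; rewrite !eM !eV ?h1 ?h2 ?h3 ?h4 ?k1 ?k2 ?k3 ?k4 ?b21; ring: bP.
  exact: mem_expgsJ.
rewrite uniD; exact: (mem_expgsM (SA _ sS) (SA _ tS)).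
Qed.

(* An element with a nonzero lower left entry is the product of an upper, a lower
   and an upper unipotent element. *)
Lemma large_set_full A : 1%g \in A -> (A^-1 = A)%g -> <<A>>%g = [set: sl2 F] ->
    (8 * #|F| ^ 8 < #|A| ^ 3)%N ->
  (A ^+ 115)%g = [set: sl2 F].
Proof.
move=> A1 AV genA big; have uA := uni_in_expgs A1 AV big.
have [a aA] := generators_move None A1 genA; rewrite fixl_None => a21.
pose w := (uni (- (e11 a / e21 a)) * a * uni (- (e22 a / e21 a)))%g.
have wA : w \in (A ^+ (16 + 1 + 16))%g by rewrite !mem_expgsM ?expg1.
have [w11 w21] : e11 w = 0 /\ e21 w = e21 a.
  rewrite /w; set u := uni (- (e11 a / _)); set v := uni (- (e22 a / _)).
  have [u1 u2 u3 u4] := uniE (- (e11 a / e21 a)); rewrite -/u in u1 u2 u3 u4.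
  have [v1 v2 v3 v4] := uniE (- (e22 a / e21 a)); rewrite -/v in v1 v2 v3 v4.
  clearbody u v; rewrite !eM u1 u2 u3 u4 v1 v3; split; last by ring.
  by field.
clearbody w; have w12 : e12 w * e21 a = -1.
  have := sl2P w; rewrite w11 w21 mul0r => /esym/eqP.
  by rewrite addrC addr_eq0 => /eqP.
have lowA (l : F) : exists2 x, x \in (A ^+ 82)%g &
    [/\ e11 x = 1, e12 x = 0, e21 x = l & e22 x = 1].
  pose v := uni (- (l / e21 a ^+ 2)).
  exists (w * v * w^-1)%g.
    exact: (@mem_expgsW _ A (16 + 1 + 16 + 16 + (16 + 1 + 16)) 82 _ A1 isT
      (mem_expgsJ AV wA (uA _))).
  have [v1 v2 v3 v4] := uniE (- (l / e21 a ^+ 2)); rewrite -/v in v1 v2 v3 v4.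
  clearbody v; have wP := sl2P w; rewrite !eM !eV v1 v2 v3 v4.
  rewrite w11 w21 in wP *; rewrite mul0r in wP.
  have wP' : e12 w * e21 a = -1 by [].
  split; try (ring: wP'); by field.
have bigcell x : e21 x != 0 -> x \in (A ^+ 114)%g.
  move=> x21; have [y yA [y1 y2 y3 y4]] := lowA (e21 x).
  have -> : x = (uni ((e11 x - 1) / e21 x)%R * y * uni ((e22 x - 1) / e21 x)%R)%g.
    set u := uni ((e11 x - 1) / e21 x)%R; set v := uni ((e22 x - 1) / e21 x)%R.
    have [u1 u2 u3 u4] := uniE ((e11 x - 1) / e21 x); rewrite -/u in u1 u2 u3 u4.
    have [v1 v2 v3 v4] := uniE ((e22 x - 1) / e21 x); rewrite -/v in v1 v2 v3 v4.
    clearbody u v; have xP := sl2P x.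
    apply: entriesP; rewrite !eM ?u1 ?u2 ?u3 ?u4 ?v1 ?v2 ?v3 ?v4 ?y1 ?y2 ?y3 ?y4; try by field.
    apply: (mulIf x21); rewrite mulrC -[LHS](addKr 1) [e21 x * _]mulrC -xP.
    by field.
  exact: (@mem_expgsW _ A (16 + 82 + 16) 114 _ A1 isT
    (mem_expgsM (mem_expgsM (uA _) yA) (uA _))).
apply/setP => x; rewrite inE.
have [x21|x21] := eqVneq (e21 x) 0; last first.
  exact: (@mem_expgsW _ A 114 115 _ A1 isT (bigcell x x21)).
have xa : (x * a)%g \in (A ^+ 114)%g.
  apply: bigcell; rewrite eM x21 mul0r add0r mulf_neq0 //.
  apply/eqP => x22; have := sl2P x; rewrite x21 x22 !mulr0 addr0 => /esym/eqP.
  by rewrite oner_eq0.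
rewrite -[x](mulgK a); apply: (@mem_expgsM _ A 114 1 _ _ xa).
by rewrite expg1 -AV inE invgK.
Qed.

End LargeSets.

(** * Growth and diameter *)

Lemma growth_arith (c : nat) : exists C0 : nat, forall a K q L : nat,
  (C0 <= a -> K ^ 24 < a ^ 25 -> a ^ 3 <= c * K ^ 2 * L ^ 3 ->
   (L <= 12) || (q ^ 2 * L <= 16 * K) -> 8 * q ^ 8 < a ^ 3)%N.
Proof.
have [c1 c1E] : exists c1, c1 = (c * 12 ^ 3)%N by exists (c * 12 ^ 3)%N.
have [c2 c2E] : exists c2, c2 = (c * 16 ^ 3)%N by exists (c * 16 ^ 3)%N.
have a72 (a : nat) : (a ^ 72 = (a ^ 3) ^ 24)%N by rewrite -expnM.
have q144 (q : nat) : (q ^ 144 = (q ^ 6) ^ 24)%N by rewrite -expnM.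
have a54 (a : nat) : (a ^ 54 = (a ^ 3) ^ 18)%N by rewrite -expnM.
have q144' (q : nat) : (q ^ 144 = (q ^ 8) ^ 18)%N by rewrite -expnM.
have a50 (a : nat) : (a ^ 50 = (a ^ 25) ^ 2)%N by rewrite -expnM.
have a125 (a : nat) : (a ^ 72 * a ^ 53 = (a ^ 25) ^ 5)%N.
  by rewrite -expnM -expnD.
exists (c1 ^ 24 + 8 ^ 18 * c2 ^ 24).+1%N => a K q L aC Ka aKL.
have a0 : (0 < a)%N by apply: leq_trans aC.
case/orP=> [L12|qL].
  have h1 : (a ^ 3 <= c1 * K ^ 2)%N.
    apply: leq_trans aKL _; rewrite c1E mulnAC.
    by rewrite leq_mul // leq_mul // leq_exp2r.
  have h2 : (a ^ 72 <= c1 ^ 24 * (K ^ 24) ^ 2)%N.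
    by rewrite (expnAC K) -expnMn a72 leq_exp2r.
  have h3 : (a ^ 72 <= c1 ^ 24 * a ^ 50)%N.
    apply: leq_trans h2 _; rewrite leq_mul2l a50 leq_exp2r //.
    by rewrite (ltnW Ka) orbT.
  have h4 : (a * a ^ 71 <= c1 ^ 24 * a ^ 71)%N.
    rewrite -expnS; apply: leq_trans h3 _.
    by rewrite leq_mul2l leq_pexp2l ?orbT.
  move: h4; rewrite leq_pmul2r ?expn_gt0 ?a0 // leqNgt => /negP[].
  by apply: leq_trans aC; rewrite ltnS leq_addr.
rewrite ltnNge; apply/negP => aq.
have h1 : (a ^ 3 * q ^ 6 <= c2 * K ^ 5)%N.
  have : (a ^ 3 * q ^ 6 <= c * K ^ 2 * (q ^ 2 * L) ^ 3)%N.
    have -> : (c * K ^ 2 * (q ^ 2 * L) ^ 3 = c * K ^ 2 * L ^ 3 * q ^ 6)%N by ring.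
    by rewrite leq_mul2r aKL orbT.
  move=> h; apply: leq_trans h _.
  have -> : (c2 * K ^ 5 = c * K ^ 2 * (16 * K) ^ 3)%N by rewrite c2E; ring.
  by rewrite leq_mul2l leq_exp2r // qL orbT.
have h2 : (a ^ 72 * q ^ 144 <= c2 ^ 24 * (K ^ 24) ^ 5)%N.
  by rewrite (expnAC K) -expnMn a72 q144 -expnMn leq_exp2r.
have h3 : (a ^ 72 * q ^ 144 <= a ^ 72 * (c2 ^ 24 * a ^ 53))%N.
  apply: leq_trans h2 _; rewrite mulnCA a125 leq_mul2l leq_exp2r //.
  by rewrite (ltnW Ka) orbT.
rewrite leq_pmul2l ?expn_gt0 ?a0 // in h3.
have h4 : (a ^ 54 <= 8 ^ 18 * q ^ 144)%N.
  by rewrite a54 q144' -expnMn leq_exp2r.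
have h5 : (a * a ^ 53 <= 8 ^ 18 * c2 ^ 24 * a ^ 53)%N.
  by rewrite -expnS -mulnA; apply: leq_trans h4 _; rewrite leq_mul2l h3 orbT.
move: h5; rewrite leq_pmul2r ?expn_gt0 ?a0 // leqNgt => /negP[].
by apply: leq_trans aC; rewrite ltnS leq_addl.
Qed.

Lemma pivot_arith (k K L : nat) : (12 < L)%N ->
    (k.+1 ^ 2 * k * (L - 6) <= K * (4 * k.+1))%N -> (1 < k.+1)%N ->
  (k.+1 ^ 2 * L <= 16 * K)%N.
Proof.
move=> L12 h k1; rewrite -(leq_pmul2r (ltn0Sn k)).
have h4 : (k.+1 ^ 2 * L * k.+1 <= k.+1 ^ 2 * (4 * (k * (L - 6))))%N.
  rewrite -mulnA leq_mul2l; apply/orP; right; nia.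
apply: leq_trans h4 _.
have -> : (k.+1 ^ 2 * (4 * (k * (L - 6))) = 4 * (k.+1 ^ 2 * k * (L - 6)))%N by ring.
by apply: leq_trans (leq_mul (leqnn 4) h) _; lia.
Qed.

Lemma growth : exists C0 : nat, forall (F : finFieldType) (A : {set sl2 F}),
    (2 : F) != 0 -> (3 : F) != 0 ->
    1%g \in A -> (A^-1 = A)%g -> <<A>>%g = [set: sl2 F] -> (C0 <= #|A|)%N ->
  (A ^+ 115)%g = [set: sl2 F] \/ (#|A| ^ 25 <= #|(A ^+ 115)%g| ^ 24)%N.
Proof.
have [C0 hC0] := growth_arith 4000.
exists (C0 + 9)%N => F A F2 F3 A1 AV genA cA.
have [grown|ngrown] := leqP (#|A| ^ 25) (#|(A ^+ 115)%g| ^ 24); [by right|left].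
set K := #|_| in ngrown.
have KA m : (m <= 115)%N -> (#|(A ^+ m)%g| <= K)%N.
  by move=> m115; apply/subset_leq_card/expgsS.
have [g0 g0A rg0] : exists2 g, g \in (A ^+ 14)%g & regular g.
  by apply: exists_regular => //; apply: leq_trans cA; rewrite addnC.
pose P g := (g \in (A ^+ 14)%g) && regular g.
have Pg0 : P g0 by rewrite /P g0A.
case: (arg_minnP (fun g => #|(A ^+ 2 :&: 'C[g])%g|) Pg0) => g1 /andP[g1A rg1] Lmin.
set L := #|_| in Lmin.
apply: large_set_full => //.
apply: (hC0 _ K #|F| L) => //; first by apply: leq_trans cA; apply: leq_addr.
  apply: leq_trans (card_cent_expgs F2 rg1 A1 AV genA g1A) _.
  by rewrite leq_mul2r leq_mul2l leq_sqr KA ?orbT.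
have [//|L12] := leqP L 12; rewrite /=.
have q1 : (1 < #|F|)%N by apply: card_finNzRing_gt1.
have L6 : (6 < L)%N by apply: leq_trans L12.
have := @pivot F A 14 L g0 F2 A1 AV genA isT g0A rg0 L6.
have Lmin' g : g \in (A ^+ 14)%g -> regular g -> (L <= #|(A ^+ 2 :&: 'C[g])%g|)%N.
  by move=> gA rg; apply: Lmin; rewrite /P gA.
move=> /(_ Lmin') h.
have h2 := leq_trans (leq_mul (card_sl2_ge F) (leqnn (L - 6))) h.
have h3 := leq_trans h2 (leq_mul (KA 2 isT) (leqnn _)).
have q0 : (0 < #|F|)%N by apply: ltnW.
have qE : #|F|.-1.+1 = #|F| by rewrite prednK.
by move: h3 q1; rewrite -qE; apply: pivot_arith.
Qed.

Lemma iterated_growth : exists2 C0 : nat, (4 <= C0)%N &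
  forall (F : finFieldType) (A : {set sl2 F}) (i : nat),
    (2 : F) != 0 -> (3 : F) != 0 ->
    1%g \in A -> (A^-1 = A)%g -> <<A>>%g = [set: sl2 F] ->
  (A ^+ (C0 * 115 ^ i))%g = [set: sl2 F] \/
  (C0 ^ (25 ^ i) <= #|(A ^+ (C0 * 115 ^ i))%g| ^ (24 ^ i))%N.
Proof.
have [C1 hC1] := growth; pose C0 := (C1 + 4)%N.
exists C0; first exact: leq_addl.
move=> F A i F2 F3 A1 AV genA.
suff [|[_ //]] : (A ^+ (C0 * 115 ^ i))%g = [set: sl2 F] \/
  (C0 <= #|(A ^+ (C0 * 115 ^ i))%g|)%N /\
  (C0 ^ (25 ^ i) <= #|(A ^+ (C0 * 115 ^ i))%g| ^ (24 ^ i))%N; [by left|by right|].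
elim: i => [|i [IHi|[IH0 IHi]]].
- rewrite !expn0 muln1 expn1 expn1; case: (expgs_grow C0 A1) => h.
    by left; rewrite h.
  by right; rewrite (ltnW h).
- left; apply/eqP; rewrite eqEsubset subsetT -IHi; apply: expgsS => //.
  by rewrite leq_mul2l expnS leq_pmull ?orbT.
set B := (A ^+ (C0 * 115 ^ i))%g in IHi IH0.
have -> : (A ^+ (C0 * 115 ^ i.+1) = B ^+ 115)%g by rewrite expnSr mulnA expgM.
have n0 : (0 < C0 * 115 ^ i)%N by rewrite muln_gt0 expn_gt0 /C0 addn4.
have B1 : 1%g \in B by apply: expgs_mem1.
have [|full|grown] := hC1 F B F2 F3 B1 (expgs_sym _ AV) (expgs_gen n0 A1 genA).
- by apply: leq_trans IH0; apply: leq_addr.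
- by left.
right; split.
  apply: leq_trans IH0 _; apply: subset_leq_card.
  by rewrite -{1}(expg1 B); apply: expgsS.
rewrite !expnSr expnM; apply: (@leq_trans ((#|B| ^ 24 ^ i) ^ 25)).
  by rewrite leq_exp2r.
by rewrite expnAC mulnC expnM leq_exp2r // expn_gt0.
Qed.

Lemma card_sl2_le (F : finFieldType) : (#|{: sl2 F}| <= #|F| ^ 4)%N.
Proof.
have -> : (#|F| ^ 4 = #|{: F * F * F * F}|)%N by rewrite !card_prod; ring.
by apply: (leq_card (@entries F)); apply: val_inj.
Qed.

Lemma ln2_ge (R : realType) : 2^-1 <= ln (2 : R).
Proof.
have : ln (1 + (- 2^-1) : R) <= - 2^-1 by apply: le_ln1Dx; lra.
have -> : 1 + - 2^-1 = 2^-1 :> R by field.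
by rewrite lnV ?posrE //; lra.
Qed.

Section Diameter.
Variable R : realType.

Lemma ln_prime_ge p : prime p -> 2^-1 <= ln (p%:R : R).
Proof.
move=> /prime_gt1 p1; apply: le_trans (ln2_ge R) _.
by rewrite ler_ln ?posrE ?ltr0n ?ler_nat // ltnW.
Qed.

(* [115 <= (25 / 24) ^ 2760] by Bernoulli, so [115 ^ i] is polynomial in
   [(25 / 24) ^ i]. *)
Lemma diameter : exists C : R, 0 < C /\
  forall (p : nat) (A : {set sl2 'F_p}), prime p ->
    1%g \in A -> (A^-1 = A)%g -> <<A>>%g = [set: sl2 'F_p] ->
  exists2 d : nat, (A ^+ d)%g = [set: sl2 'F_p] & d%:R <= C * ln (p%:R : R) ^+ 2760.
Proof.
have [C0 C04 hC0] := iterated_growth.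
have [c cE] : exists c : nat, c = 2760%N by exists 2760%N.
rewrite -cE; pose C : R := 115 * C0%:R * 4 ^+ c + 81 * 2 ^+ c.
have p1 : 0 <= 115 * C0%:R * 4 ^+ c :> R by rewrite !mulr_ge0 ?exprn_ge0 ?ler0n.
have p2 : 0 < 81 * 2 ^+ c :> R by rewrite mulr_gt0 ?exprn_gt0.
exists C; split; first by rewrite /C; lra.
move=> p A pr A1 AV genA; set l := ln _; have l2 : 2^-1 <= l := ln_prime_ge pr.
have l0 : 0 <= l by apply: le_trans l2; rewrite invr_ge0.
have cF : #|'F_p| = p by apply: card_Fp.
have cle n : (#|(A ^+ n)%g| <= p ^ 4)%N.
  have := card_sl2_le 'F_p; rewrite cF; apply: leq_trans; exact: max_card.
have [p5|p5] := leqP 5 p; last first.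
  exists 81%N.
    case: (expgs_grow 81 A1) => [-> //|]; rewrite ltnNge => /negP[].
    apply: leq_trans (cle _) _; move: pr p5; clear.
    by case: p => [|[|[|[|[|]]]]].
  apply: (@le_trans _ _ (81 * 2 ^+ c * l ^+ c)).
    rewrite -mulrA -exprMn ler_peMr // exprn_ege1 //; lra.
  by rewrite ler_wpM2r ?exprn_ge0 // /C; lra.
have nz n : (1 < n < 5)%N -> n != 4 -> (n%:R : 'F_p) != 0.
  move=> n5 n4; rewrite -(dvdn_pcharf (pchar_Fp pr)).
  apply/negP => /dvdn_leq; case/andP: n5 => n1 n5.
  by rewrite (ltnW n1) => /(_ isT); lia.
have F2 := nz 2%N isT isT; have F3 := nz 3%N isT isT.
pose r : R := 25 / 24.
have r1 : r = 1 + 24^-1 by rewrite /r; field.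
have rc : 115 <= r ^+ c.
  have h24 : 0 <= 24^-1 :> R by rewrite invr_ge0.
  apply: le_trans (_ : 1 + c%:R * 24^-1 <= _); last by rewrite r1; apply: Bernoulli.
  by rewrite cE; have -> : 2760%:R * 24^-1 = 115 :> R; [field | lra].
have [i0 hi0] : exists i : nat, 4 * l < r ^+ i.
  exists (Num.truncn (24 * (4 * l))).+1.
  have h24 : 0 <= 24^-1 :> R by rewrite invr_ge0.
  rewrite r1; apply: lt_le_trans (Bernoulli _ h24).
  have := truncnS_gt (24 * (4 * l)); move: (Num.truncn _).+1%:R => m hm.
  have : 4 * l < m * 24^-1 by rewrite ltr_pdivlMr //; lra.
  by lra.
have exi : exists i : nat, 4 * l < r ^+ i by exists i0.
case: (ex_minnP exi) => i hi mini.
have ipos : (0 < i)%N.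
  by rewrite lt0n; apply/eqP => iz; move: hi; rewrite iz expr0; lra.
have hi1 : r ^+ i.-1 <= 4 * l.
  rewrite leNgt; apply/negP => /mini; rewrite leqNgt prednK //.
  by rewrite leqnn.
exists (C0 * 115 ^ i)%N.
  have [//|h] := hC0 _ A i F2 F3 A1 AV genA.
  have {}h : (C0 ^ 25 ^ i <= (p ^ 4) ^ 24 ^ i)%N.
    by apply: leq_trans h _; rewrite leq_exp2r // expn_gt0.
  have C00 : (0 < C0)%N by apply: leq_trans C04.
  have p0 : (0 < p)%N by apply: prime_gt0.
  have : ln (C0 ^ 25 ^ i)%:R <= ln ((p ^ 4) ^ 24 ^ i)%:R :> R.
    by rewrite ler_ln ?posrE ?ltr0n ?ler_nat ?expn_gt0 ?C00 ?p0.
  have -> : ln (C0 ^ 25 ^ i)%:R = 25%:R ^+ i * ln C0%:R :> R.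
    by rewrite -natrX natrX lnXn ?ltr0n // mulr_natl.
  have -> : ln ((p ^ 4) ^ 24 ^ i)%:R = 24%:R ^+ i * (4 * l) :> R.
    rewrite -[24%:R ^+ i]natrX [in LHS]natrX lnXn ?ltr0n ?expn_gt0 ?p0 //.
    by rewrite natrX lnXn ?ltr0n // !mulr_natl.
  move=> hh.
  have lC0 : 1 <= ln (C0%:R : R).
    apply: (@le_trans _ _ (ln (4%:R : R))).
      have -> : 4%:R = 2 ^+ 2 :> R by ring.
      by rewrite lnXn // mulr2n; have := ln2_ge R; lra.
    by rewrite ler_ln ?posrE ?ltr0n ?ler_nat.
  have h25 : 25%:R ^+ i <= 24%:R ^+ i * (4 * l) :> R.
    apply: le_trans hh; rewrite ler_peMr ?exprn_ge0 //.
  exfalso; move: hi; rewrite ltNge => /negP[].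
  rewrite /r expr_div_n ler_pdivrMr ?exprn_gt0 //.
  by rewrite mulrC.
rewrite natrM natrX -(prednK ipos) exprS mulrCA.
have h115 : 115%:R ^+ i.-1 <= 4 ^+ c * l ^+ c :> R.
  rewrite -exprMn; apply: (@le_trans _ _ ((r ^+ c) ^+ i.-1)).
    by rewrite lerXn2r ?nnegrE // (le_trans _ rc).
  rewrite -exprM mulnC exprM lerXn2r ?nnegrE ?mulr_ge0 //.
  by rewrite exprn_ge0 // divr_ge0.
apply: (@le_trans _ _ (115 * C0%:R * 4 ^+ c * l ^+ c)).
  by rewrite -!mulrA ler_wpM2l // ler_wpM2l // mulrA.
by rewrite ler_wpM2r ?exprn_ge0 // /C; lra.
Qed.

End Diameter.

(** * Mixing time and diameter *)

Section Mixing.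
Variables (R : realType) (gT : finGroupType) (G : {group gT}) (A : {set gT}).
Hypotheses (AV : (A^-1 = A)%g) (AG : A \subset G) (A0 : (0 < #|A|)%N).
Implicit Types (f : gT -> R) (x y g : gT).

Definition walk_op f x : R :=
  2^-1 * f x + (2 * #|A|%:R)^-1 * \sum_(a in A) f (x * a)%g.

Definition sqnorm f : R := \sum_(x in G) f x ^+ 2.
Definition energy g f : R := \sum_(x in G) (f (x * g)%g - f x) ^+ 2.

Let nA : R := #|A|%:R.
Let nA0 : 0 < nA. Proof. by rewrite ltr0n. Qed.

Lemma sum_mulgr f g : g \in G -> \sum_(x in G) f (x * g)%g = \sum_(x in G) f x.
Proof.
move=> gG; rewrite [RHS](reindex_inj (mulIg g)).
by apply: eq_bigl => x; rewrite groupMr.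
Qed.

Lemma energy_ge0 g f : 0 <= energy g f.
Proof. by apply: sumr_ge0 => x _; apply: sqr_ge0. Qed.

Lemma walk_op_avg f x :
  walk_op f x = nA^-1 * \sum_(a in A) (f x + f (x * a)%g) / 2.
Proof.
rewrite /walk_op -mulr_suml big_split /= sumr_const -/nA -[_ *+ _]mulr_natl -/nA.
by field; rewrite gt_eqF.
Qed.

Lemma sum_walk_op f : \sum_(x in G) walk_op f x = \sum_(x in G) f x.
Proof.
rewrite big_split /= -!mulr_sumr exchange_big /=.
have -> : \sum_(a in A) \sum_(x in G) f (x * a)%g = nA * \sum_(x in G) f x.
  rewrite mulr_natl -sumr_const; apply: eq_bigr => a aA.
  by rewrite (sum_mulgr f) // (subsetP AG).
rewrite -/nA; field.
by rewrite gt_eqF.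
Qed.

Lemma sqnorm_walk_op f :
  sqnorm (walk_op f) <= sqnorm f - (4 * nA)^-1 * \sum_(a in A) energy a f.
Proof.
have pt x : walk_op f x ^+ 2 <= nA^-1 * \sum_(a in A) ((f x + f (x * a)%g) / 2) ^+ 2.
  rewrite walk_op_avg exprMn [nA^-1 ^+ 2]expr2 -mulrA ler_pM2l ?invr_gt0 //.
  rewrite ler_pdivrMl //; exact: Cauchy_Schwarz_sum.
apply: (@le_trans _ _ (\sum_(x in G) (nA^-1 * \sum_(a in A) ((f x + f (x * a)%g) / 2) ^+ 2))).
  by apply: ler_sum => x _; apply: pt.
rewrite -mulr_sumr exchange_big /=.
rewrite (eq_bigr (fun a => sqnorm f - 4^-1 * energy a f)); last first.
  move=> a aA; have aG := subsetP AG a aA.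
  have sq : \sum_(x in G) f (x * a)%g ^+ 2 = sqnorm f.
    exact: (sum_mulgr (fun x => f x ^+ 2)).
  have -> : sqnorm f = 2^-1 * sqnorm f + 2^-1 * \sum_(x in G) f (x * a)%g ^+ 2.
    by rewrite sq; field.
  rewrite /sqnorm /energy !mulr_sumr -big_split -sumrB /=.
  by apply: eq_bigr => x _; field.
rewrite sumrB sumr_const -mulr_sumr -[_ *+ _]mulr_natl -/nA.
rewrite le_eqVlt; apply/orP; left; apply/eqP; field.
by rewrite gt_eqF.
Qed.

Lemma energy_expgs f n g : g \in ((1%g |: A) ^+ n)%g ->
  energy g f <= n%:R ^+ 2 * \sum_(a in A) energy a f.
Proof.
set D := \sum_(a in A) _.
have BG : (1%g |: A) \subset G by rewrite subUset sub1set group1.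
have e1 : energy 1%g f = 0.
  by rewrite /energy big1 // => x _; rewrite mulg1 subrr expr0n.
have D0 : 0 <= D by apply: sumr_ge0 => a _; apply: energy_ge0.
have eD a : a \in 1%g |: A -> energy a f <= D.
  rewrite inE => /orP[/set1P -> | aA]; first by rewrite e1.
  rewrite /D (bigD1 a) //= lerDl; apply: sumr_ge0 => b _; apply: energy_ge0.
elim: n g => [|n IHn] g; first by rewrite expg0 inE => /eqP ->; rewrite e1 expr0n mul0r.
rewrite expgSr => /mulsgP[h a hB aB ->].
have [n0|n0] := posnP n.
  move: hB; rewrite n0 expg0 inE => /eqP ->; rewrite mul1g expr1n mul1r.
  exact: eD.
have hG : h \in G by apply: (subsetP (expgs_sub n BG)).
have nR : 0 < n%:R :> R by rewrite ltr0n.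
rewrite -(ler_pM2l nR).
apply: (@le_trans _ _ (n%:R * n.+1%:R * energy a f + n.+1%:R * energy h f)).
  have -> : energy a f = \sum_(x in G) (f (x * h * a)%g - f (x * h)%g) ^+ 2.
    by rewrite (sum_mulgr (fun x => (f (x * a)%g - f x) ^+ 2)).
  rewrite /energy !mulr_sumr -big_split /=; apply: ler_sum => x _.
  rewrite mulgA; move: (f _) (f _) (f _) => v w u.
  rewrite -subr_ge0 -natr1.
  have -> : n%:R * (n%:R + 1) * (u - v) ^+ 2 + (n%:R + 1) * (v - w) ^+ 2 -
    n%:R * (u - w) ^+ 2 = (n%:R * (u - v) - (v - w)) ^+ 2 by ring.
  exact: sqr_ge0.
apply: (@le_trans _ _ (n%:R * n.+1%:R * D + n.+1%:R * (n%:R ^+ 2 * D))).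
  by rewrite lerD // ler_wpM2l ?mulr_ge0 ?ler0n ?eD // IHn.
by rewrite -natr1 le_eqVlt; apply/orP; left; apply/eqP; ring.
Qed.

Lemma sum_energy f : \sum_(x in G) f x = 0 ->
  \sum_(g in G) energy g f = 2 * #|G|%:R * sqnorm f.
Proof.
move=> f0; rewrite exchange_big /=.
have e x : x \in G -> \sum_(g in G) (f (x * g)%g - f x) ^+ 2 =
    sqnorm f + #|G|%:R * f x ^+ 2.
  move=> xG.
  have -> : \sum_(g in G) (f (x * g)%g - f x) ^+ 2 = \sum_(y in G) (f y - f x) ^+ 2.
    rewrite [RHS](reindex_inj (mulgI x)).
    by apply: eq_bigl => y; rewrite groupMl.
  under eq_bigr => y _ do rewrite sqrrB.
  rewrite big_split big_split /= sumrN sumrMnl -mulr_suml f0 mul0r mul0rn oppr0.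
  by rewrite addr0 sumr_const mulr_natl.
rewrite (eq_bigr _ e) big_split /= sumr_const -mulr_sumr -/(sqnorm f).
by rewrite -[_ *+ _]mulr_natl; ring.
Qed.

Lemma sqnorm_decay f d : (0 < d)%N -> G \subset ((1%g |: A) ^+ d)%g ->
    \sum_(x in G) f x = 0 ->
  sqnorm (walk_op f) <= (1 - (2 * nA * d%:R ^+ 2)^-1) * sqnorm f.
Proof.
move=> d0 dG f0; set D := \sum_(a in A) energy a f.
have dR : 0 < d%:R ^+ 2 :> R by rewrite exprn_gt0 ?ltr0n.
have : #|G|%:R * (2 * sqnorm f) <= #|G|%:R * (d%:R ^+ 2 * D).
  have -> : #|G|%:R * (2 * sqnorm f) = 2 * #|G|%:R * sqnorm f by ring.
  rewrite -sum_energy // mulr_natl -sumr_const; apply: ler_sum => g gG.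
  by apply: energy_expgs; apply: (subsetP dG).
rewrite ler_pM2l ?ltr0n ?cardG_gt0 // => poincare.
apply: le_trans (sqnorm_walk_op f) _; rewrite -/D mulrBl mul1r lerD2l lerN2.
have -> : (2 * nA * d%:R ^+ 2)^-1 * sqnorm f =
   (4 * nA)^-1 * ((d%:R ^+ 2)^-1 * (2 * sqnorm f)).
  by field; rewrite !gt_eqF // ltr0n.
rewrite ler_pM2l ?invr_gt0 ?mulr_gt0 // ler_pdivrMl //.
Qed.

Lemma walk_opB f c : walk_op (fun x => f x - c) =1 (fun x => walk_op f x - c).
Proof.
move=> x; rewrite /walk_op sumrB sumr_const -[_ *+ #|A|]mulr_natl -/nA.
by field; rewrite gt_eqF.
Qed.

Definition walk n x0 : gT -> R := iter n walk_op (fun x => (x == x0)%:R).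

Lemma walk_distE n g0 (i : 'I_#|G|) :
  walk_dist R G A n g0 i ord0 = walk n g0 (enum_val i).
Proof.
elim: n i => [|n IHn] i; first by rewrite /walk_dist expr0 mul1mx mxE.
have -> : walk_dist R G A n.+1 g0 = transition_mx R G A *m walk_dist R G A n g0.
  by rewrite /walk_dist exprS mulmxA.
rewrite mxE; set x := enum_val i; have xG : x \in G := enum_valP i.
transitivity (\sum_(y in G) lazy_dist R A (y^-1 * x)%g * walk n g0 y).
  by rewrite [RHS]big_enum_val; apply: eq_bigr => j _; rewrite mxE IHn.
rewrite /= -/(walk n g0) /walk_op; move: (walk n g0) => f.
have split g : lazy_dist R A g = 2^-1 * (g == 1%g)%:R + (2 * nA)^-1 * (g \in A)%:R.
  rewrite /lazy_dist -/nA; case: eqP => _; first by rewrite mulr1 addrC.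
  by rewrite mulr0 add0r.
under eq_bigr => y _ do rewrite split mulrDl -!mulrA.
rewrite big_split /= -!mulr_sumr; congr (_ * _ + _ * _).
  rewrite (bigD1 x) //= mulVg eqxx mul1r big1 ?addr0 // => y /andP[_ yx].
  by rewrite -eq_mulVg1 (negPf yx) mul0r.
rewrite (big_setID A) /= [X in _ = X](eq_bigr (fun a => f (x * a)%g)) //.
transitivity (\sum_(y in G | (y^-1 * x)%g \in A) f y).
  rewrite [RHS]big_mkcondr; rewrite -big_setID; apply: eq_bigr => y _.
  by case: (_ \in A); rewrite ?mul1r ?mul0r.
rewrite (reindex_inj (mulgI x)) /=; apply: eq_bigl => a.
rewrite invMg mulgKV -[in X in _ && X]AV inE invgK groupMl //.
by apply: andb_idl => /(subsetP AG).
Qed.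

Lemma sum_walk n g0 : g0 \in G -> \sum_(x in G) walk n g0 x = 1.
Proof.
move=> g0G; elim: n => [|n IHn]; last by rewrite /= sum_walk_op.
rewrite (bigD1 g0) //= eqxx big1 ?addr0 // => x /andP[_ /negPf xg].
by rewrite /walk /= xg.
Qed.

Lemma sqnormB f c : sqnorm (fun x => f x - c) =
  sqnorm f - 2 * c * \sum_(x in G) f x + #|G|%:R * c ^+ 2.
Proof.
rewrite [#|G|%:R * _]mulr_natl -sumr_const /sqnorm mulr_sumr -sumrB -big_split /=.
by apply: eq_bigr => x _; ring.
Qed.

Lemma sqnorm_walk n g0 d : (0 < d)%N -> G \subset ((1%g |: A) ^+ d)%g ->
    g0 \in G ->
  sqnorm (fun x => walk n g0 x - #|G|%:R^-1) <=
    (1 - (2 * nA * d%:R ^+ 2)^-1) ^+ n.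
Proof.
move=> d0 dG g0G; set th := (2 * _ * _)^-1; have nG : 0 < #|G|%:R :> R by rewrite ltr0n cardG_gt0.
have d1 : 1 <= d%:R :> R by rewrite ler1n.
have A1 : 1 <= nA by rewrite ler1n.
have th1 : 0 <= 1 - th.
  rewrite subr_ge0 invf_le1; last by rewrite !mulr_gt0 // ltr0n.
  have : 1 <= d%:R ^+ 2 :> R by apply: exprn_ege1.
  by nra.
have mean0 m : \sum_(x in G) (walk m g0 x - #|G|%:R^-1) = 0.
  by rewrite sumrB sum_walk // sumr_const -[_ *+ _]mulr_natl divff ?subrr // gt_eqF.
elim: n => [|n IHn].
  rewrite expr0 sqnormB sum_walk //.
  have -> : sqnorm (walk 0 g0) = 1.
    rewrite /sqnorm (bigD1 g0) //= big1; first by rewrite /walk /= eqxx expr1n addr0.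
    by move=> x /andP[_ /negPf xg]; rewrite /walk /= xg expr0n.
  have -> : #|G|%:R * #|G|%:R^-1 ^+ 2 = #|G|%:R^-1 :> R by field; rewrite gt_eqF.
  have : 0 < #|G|%:R^-1 :> R by rewrite invr_gt0.
  by lra.
apply: (@le_trans _ _ ((1 - th) * sqnorm (fun x => walk n g0 x - #|G|%:R^-1))).
  apply: le_trans (sqnorm_decay d0 dG (mean0 n)).
  rewrite /sqnorm le_eqVlt; apply/orP; left; apply/eqP; apply: eq_bigr => x _.
  by rewrite walk_opB.
by rewrite exprS ler_wpM2l.
Qed.

Lemma mixedE n g0 : mixed R G A n g0 <->
  \sum_(x in G) `|walk n g0 x - #|G|%:R^-1| <= 2^-1.
Proof.
rewrite /mixed [in X in _ <-> X]big_enum_val.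
by under eq_bigr => i _ do rewrite walk_distE.
Qed.

Lemma mixed_large n g0 d : (0 < d)%N -> G \subset ((1%g |: A) ^+ d)%g ->
    g0 \in G -> 2 * nA * d%:R ^+ 2 * ln (4 * #|G|%:R) <= n%:R ->
  mixed R G A n g0.
Proof.
move=> d0 dG g0G hn; apply/mixedE.
have nG : 0 < #|G|%:R :> R by rewrite ltr0n cardG_gt0.
set S := \sum_(x in G) _.
have S0 : 0 <= S by apply: sumr_ge0 => x _; apply: normr_ge0.
rewrite -(ler_pXn2r (n := 2)) ?nnegrE ?invr_ge0 //.
apply: le_trans (Cauchy_Schwarz_sum _ _) _.
under eq_bigr => x _ do rewrite real_normK ?num_real //.
apply: (@le_trans _ _ (#|G|%:R * (1 - (2 * nA * d%:R ^+ 2)^-1) ^+ n)).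
  by rewrite ler_wpM2l ?ler0n //; apply: sqnorm_walk.
have th0 : 0 < 2 * nA * d%:R ^+ 2 by rewrite !mulr_gt0 ?exprn_gt0 ?ltr0n.
set th := (2 * _ * _)^-1.
apply: (@le_trans _ _ (#|G|%:R * expR (- th * n%:R))).
  rewrite ler_wpM2l ?ler0n // expRM_natr lerXn2r ?nnegrE ?expR_ge0 //; last first.
    by have := expR_ge1Dx (- th).
  rewrite subr_ge0 invf_le1 //.
  have d1 : 1 <= d%:R ^+ 2 :> R by apply: exprn_ege1; rewrite ler1n.
  have A1 : 1 <= nA by rewrite ler1n.
  by nra.
apply: (@le_trans _ _ (#|G|%:R * expR (- ln (4 * #|G|%:R)))).
  rewrite ler_wpM2l ?ler0n // ler_expR mulNr lerN2.
  by rewrite ler_pdivlMl.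
rewrite expRN lnK ?posrE ?mulr_gt0 //.
by rewrite le_eqVlt; apply/orP; left; apply/eqP; field; rewrite gt_eqF.
Qed.

Lemma walk_mulg n h g0 x : walk n (h * g0)%g (h * x)%g = walk n g0 x.
Proof.
elim: n x => [|n IHn] x; first by rewrite /walk /= (inj_eq (mulgI h)).
rewrite /= /walk_op IHn; congr (_ + _ * _); apply: eq_bigr => a _.
by rewrite -mulgA IHn.
Qed.

Lemma mixed_indep n g0 : g0 \in G -> mixed R G A n g0 <-> mixed R G A n 1%g.
Proof.
move=> g0G; rewrite !mixedE.
have -> : \sum_(x in G) `|walk n g0 x - #|G|%:R^-1| =
          \sum_(x in G) `|walk n 1%g x - #|G|%:R^-1|; last by [].
rewrite (reindex_inj (mulgI g0)) /=; apply: eq_big => [x|x _].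
  by rewrite groupMl.
by rewrite -{1}(mulg1 g0) walk_mulg.
Qed.

Lemma mixing_time_exists d : (0 < d)%N -> G \subset ((1%g |: A) ^+ d)%g ->
  exists2 n, is_mixing_time R G A n &
    n%:R <= 2 * nA * d%:R ^+ 2 * ln (4 * #|G|%:R) + 1.
Proof.
move=> d0 dG; set t := 2 * nA * _ * _.
pose P n := (0 < n)%N && (\sum_(x in G) `|walk n 1%g x - #|G|%:R^-1| <= 2^-1 :> R).
have Pmix n : P n <-> (0 < n)%N /\ mixed R G A n 1%g.
  by rewrite mixedE; split=> [/andP|[*]]; last apply/andP.
have t0 : 0 <= t.
  rewrite !mulr_ge0 ?exprn_ge0 ?ler0n // ?ln_ge0 //.
  have : 1 <= #|G|%:R :> R by rewrite ler1n cardG_gt0.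
  by lra.
have PN : P (Num.truncn t).+1.
  apply/Pmix; split=> //; apply: (mixed_large d0 dG (group1 G)).
  by apply: ltW; apply: truncnS_gt.
have exP : exists n, P n by exists (Num.truncn t).+1.
case: (ex_minnP exP) => n /Pmix[n0 mixn] minn; exists n.
  move=> g0 g0G; split=> //; first exact/mixed_indep.
  by move=> m m0 /(mixed_indep _ g0G) mixm; apply: minn; apply/Pmix.
apply: (@le_trans _ _ (Num.truncn t).+1%:R); first by rewrite ler_nat minn.
by rewrite -natr1 lerD2r truncn_le.
Qed.

End Mixing.

(** * Transfer to GL_2 *)

Section Transfer.
Local Open Scope group_scope.
Variables (gT rT : finGroupType) (f : gT -> rT).
Hypotheses (fM : {morph f : x y / x * y}) (f_inj : injective f).
Variables (G : {group rT}) (A : {set rT}).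
Hypotheses (fG : f @: [set: gT] = G) (AV : A^-1 = A) (genA : <<A>> = G).

Definition preim_generators : {set gT} := f @^-1: (1 |: A).
Local Notation B := preim_generators.

Let f1 : f 1 = 1.
Proof. by apply: (mulgI (f 1)); rewrite -fM !mulg1. Qed.

Let fV x : f x^-1 = (f x)^-1.
Proof. by apply: (mulgI (f x)); rewrite -fM !mulgV f1. Qed.

Lemma preim_expgs n x : (f x \in (1 |: A) ^+ n) = (x \in B ^+ n).
Proof.
have AG : 1 |: A \subset G by rewrite subUset sub1set group1 -genA subset_gen.
apply/idP/idP; elim: n x => [|n IHn] x.
- by rewrite !expg0 !inE -f1 => /eqP/f_inj ->.
- rewrite !expgS => /mulsgP[a b aA bA fx].
  have : a \in f @: [set: gT] by rewrite fG (subsetP AG).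
  case/imsetP=> a' _ aE; rewrite -(mulKVg a' x) mem_mulg //.
    by rewrite inE -aE.
  by apply: IHn; rewrite fM fV fx aE mulKg.
- by rewrite !expg0 !inE => /eqP ->; rewrite f1.
- rewrite !expgS => /mulsgP[a b]; rewrite inE => aB bB ->.
  by rewrite fM mem_mulg // IHn.
Qed.

Lemma preim_generators1 : 1 \in B.
Proof. by rewrite inE f1 setU11. Qed.

Lemma preim_generatorsV : B^-1 = B.
Proof.
have memB y : (y \in B) = (f y \in 1 |: A) by rewrite inE.
have UV : (1 |: A)^-1 = 1 |: A by rewrite invUg invg_set1 invg1 AV.
by apply/setP => x; rewrite mem_invg !memB fV -mem_invg UV.
Qed.

Lemma preim_generators_gen : <<B>> = [set: gT].
Proof.
apply/eqP; rewrite eqEsubset subsetT; apply/subsetP => x _.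
have [n An] := expgs_full (setU11 1 A).
have genUA : <<1 |: A>> = G.
  apply/eqP; rewrite eqEsubset gen_subG subUset sub1set group1 -{1}genA.
  by rewrite subset_gen -genA genS // subsetUr.
apply: (subsetP (expgs_sub n (subset_gen B))).
by rewrite -preim_expgs An genUA -fG imset_f.
Qed.

Lemma preim_expgs_full d : B ^+ d = [set: gT] -> G \subset (1 |: A) ^+ d.
Proof.
move=> Bd; rewrite -fG; apply/subsetP => _ /imsetP[x _ ->].
by rewrite preim_expgs Bd inE.
Qed.

End Transfer.

Section Embedding.
Variable F : finFieldType.
Implicit Types x y : sl2 F.

Definition sl2_mx x : 'M[F]_2 := \matrix_(i, j)
  if i == 0 then if j == 0 then e11 x else e12 x
  else if j == 0 then e21 x else e22 x.

Lemma det_mx2 (M : 'M[F]_2) : \det M = M 0 0 * M 1 1 - M 0 1 * M 1 0.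
Proof.
rewrite (expand_det_row _ 0) !big_ord_recl big_ord0 addr0 /cofactor !det_mx11.
rewrite !mxE /= expr0 expr1 mul1r mulN1r mulrN.
by congr (_ * M _ _ - M _ _ * M _ _); apply/val_inj.
Qed.

Lemma mul_mx2 (M N : 'M[F]_2) i j :
  (M *m N) i j = M i 0 * N 0 j + M i 1 * N 1 j.
Proof.
rewrite mxE !big_ord_recl big_ord0 addr0.
by congr (_ * _ + M i _ * N _ j); apply/val_inj.
Qed.

Lemma eq_mx2 (M N : 'M[F]_2) :
  M 0 0 = N 0 0 -> M 0 1 = N 0 1 -> M 1 0 = N 1 0 -> M 1 1 = N 1 1 -> M = N.
Proof.
move=> h11 h12 h21 h22; apply/matrixP => i j.
have ordP (k : 'I_2) : k = 0 \/ k = 1.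
  by case: k => -[|[|//]] ltk; [left|right]; apply/val_inj.
by case: (ordP i) => ->; case: (ordP j) => ->.
Qed.

Lemma det_sl2_mx x : \det (sl2_mx x) = 1.
Proof. by rewrite det_mx2 !mxE /= sl2P addrK. Qed.

Lemma sl2_mx_unit x : sl2_mx x \is a GRing.unit.
Proof. by rewrite unitmxE det_sl2_mx unitr1. Qed.

Definition sl2_GL x : {'GL_2[F]} := Sub (sl2_mx x) (sl2_mx_unit x).

Lemma GLval_sl2_GL x : GLval (sl2_GL x) = sl2_mx x.
Proof. by []. Qed.

Lemma sl2_GL_M : {morph sl2_GL : x y / (x * y)%g}.
Proof.
move=> x y; apply: val_inj; rewrite [RHS]GL_MxE/=.
by apply: eq_mx2; rewrite mul_mx2 !mxE /= !eM.
Qed.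

Lemma sl2_GL_inj : injective sl2_GL.
Proof.
move=> x y /(congr1 (@GLval _ _)); rewrite !GLval_sl2_GL => /matrixP h.
have := h 0 0; have := h 0 1; have := h 1 0; have := h 1 1.
by rewrite !mxE /= => *; apply: entriesP.
Qed.

Lemma sl2_GL_image : sl2_GL @: [set: sl2 F] = SL 2 F.
Proof.
apply/setP => u; apply/imsetP/idP => [[x _ ->]|].
  by rewrite inE GLval_sl2_GL det_sl2_mx.
rewrite inE (det_mx2 (GLval u)) subr_eq => /eqP detu.
have [x [h1 h2 h3 h4]] := sl2_ex detu.
exists x; rewrite ?inE //; apply: val_inj; rewrite /= -/(GLval u).
by apply: eq_mx2; rewrite mxE /= ?h1 ?h2 ?h3 ?h4.
Qed.
End Embedding.

Lemma SL2_generators_neq0 (F : finFieldType) (A : {set {'GL_2[F]}}) :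
  <<A>>%g = SL 2 F -> (0 < #|A|)%N.
Proof.
move=> genA; rewrite card_gt0; apply/eqP => A0; rewrite A0 gen0 in genA.
have : sl2_GL (uni 1) \in (SL 2 F : {set _}) by rewrite -sl2_GL_image imset_f ?inE.
rewrite -genA => /set1P /(congr1 (@GLval _ _)) /matrixP /(_ 0 1) /eqP.
by rewrite GLval_sl2_GL GL_1E !mxE /= (negPf (oner_neq0 _)).
Qed.

Lemma card_SL2_le (F : finFieldType) : (#|SL 2 F| <= #|F| ^ 4)%N.
Proof.
rewrite -[#|_|]/#|(SL 2 F : {set _})| -sl2_GL_image.
by apply: leq_trans (leq_imset_card _ _) _; rewrite cardsT card_sl2_le.
Qed.

Lemma mixing_time_arith (R : realType) (c d n : nat) (C1 a g l : R) :
    0 <= C1 -> 2^-1 <= l -> 1 <= a -> d%:R <= C1 * l ^+ c -> g <= 6 * l ->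
    n%:R <= 2 * a * d.+1%:R ^+ 2 * g + 1 ->
  n%:R <= (12 * (C1 + 2 ^+ c) ^+ 2 + 2 ^+ (2 * c).+1) * a * l ^+ (2 * c).+1.
Proof.
move=> C0 l2 a1 dC gl hn; have l0 : 0 <= l by lra.
have one k : 1 <= 2 ^+ k * l ^+ k.
  by rewrite -exprMn; apply: exprn_ege1; lra.
have d1 : d.+1%:R <= (C1 + 2 ^+ c) * l ^+ c.
  by rewrite -natr1 mulrDl lerD.
have d2 : d.+1%:R ^+ 2 <= (C1 + 2 ^+ c) ^+ 2 * l ^+ (2 * c).
  have -> : (C1 + 2 ^+ c) ^+ 2 * l ^+ (2 * c) = ((C1 + 2 ^+ c) * l ^+ c) ^+ 2.
    by rewrite exprMn -exprM mulnC.
  rewrite lerXn2r ?nnegrE //; apply: le_trans d1; exact: ler0n.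
apply: le_trans hn _.
rewrite [(_ + 2 ^+ _.+1) * a]mulrDl [(_ + 2 ^+ _.+1 * a) * _]mulrDl; apply: lerD.
  apply: (@le_trans _ _ (2 * a * d.+1%:R ^+ 2 * (6 * l))).
    by rewrite ler_wpM2l // !mulr_ge0 ?exprn_ge0 //; lra.
  have -> : 12 * (C1 + 2 ^+ c) ^+ 2 * a * l ^+ (2 * c).+1 =
    2 * a * ((C1 + 2 ^+ c) ^+ 2 * l ^+ (2 * c)) * (6 * l) by rewrite (exprS l); ring.
  by rewrite ler_wpM2r ?ler_wpM2l ?mulr_ge0 //; lra.
rewrite mulrAC; apply: le_trans (one (2 * c).+1) _; rewrite ler_peMr //.
by rewrite mulr_ge0 ?exprn_ge0.
Qed.

Theorem corollary6p2 (R : realType) :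
  exists c C : R, 0 < c /\ 0 < C /\
    forall (p : nat) (A : {set {'GL_2['F_p]}}),
      prime p ->
      symmetric_generators (SL 2 'F_p) A ->
      exists n : nat,
        is_mixing_time R (SL 2 'F_p) A n /\
        n%:R <= C * #|A|%:R * (ln (p%:R : R)) `^ (2 * c + 1).
Proof.
have [C1 [C1_gt0 hC1]] := diameter R.
have [c cE] : exists c : nat, c = 2760%N by exists 2760%N.
rewrite -cE in hC1.
exists c%:R, (12 * (C1 + 2 ^+ c) ^+ 2 + 2 ^+ (2 * c).+1); split.
  by rewrite ltr0n cE.
split.
  by rewrite addr_gt0 ?mulr_gt0 ?exprn_gt0 // addr_gt0 ?exprn_gt0.
move=> p A pr [AV genA].
have A0 : (0 < #|A|)%N := SL2_generators_neq0 genA.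
have AG : A \subset SL 2 'F_p by rewrite -genA subset_gen.
have fM := @sl2_GL_M 'F_p; have finj := @sl2_GL_inj 'F_p.
have fG := @sl2_GL_image 'F_p.
have [d Bd dle] := hC1 p _ pr (preim_generators1 fM A)
  (preim_generatorsV fM AV) (preim_generators_gen fM finj fG genA).
have Ad := preim_expgs_full fM finj fG genA Bd.
have Ad1 : (SL 2 'F_p \subset (1%g |: A) ^+ d.+1)%g.
  by apply: subset_trans Ad _; apply: expgsS; rewrite ?setU11.
have [n mixn nle] := mixing_time_exists R AV AG A0 (ltn0Sn d) Ad1.
exists n; split=> //.
have l2 := ln_prime_ge R pr; set l := ln _ in dle l2 *.
have -> : 2 * c%:R + 1 = (2 * c).+1%:R :> R by rewrite -[RHS]natr1 [in RHS]natrM.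
rewrite powR_mulrn; last by apply: le_trans l2; rewrite invr_ge0.
apply: (mixing_time_arith (ltW C1_gt0) l2 _ dle _ nle); first by rewrite ler1n.
have cG : (4 * #|SL 2 'F_p| <= p ^ 6)%N.
  rewrite (expnD p 2 4); apply: leq_mul.
    by have := prime_gt1 pr; rewrite -(leq_sqr 2 p).
  by have := card_SL2_le 'F_p; rewrite card_Fp.
have -> : 6 * l = ln ((p ^ 6)%N%:R : R).
  by rewrite natrX lnXn ?ltr0n ?prime_gt0 // mulr_natl.
have p6 : (0 < p ^ 6)%N by rewrite expn_gt0 prime_gt0.
have G4 : (0 < 4 * #|SL 2 'F_p|)%N by rewrite muln_gt0 cardG_gt0.
by rewrite -natrM ler_ln ?posrE ?ltr0n // ler_nat.
Qed.
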